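(* (a) For every $d \ge 1$, $\dfrac{W_n}{\ln\ln n} \to d-1$ in probability as $n \to \infty$. (b) If $d \ge 2$, then almost surely \[ \liminf_{n\to\infty} \frac{W_n}{\ln\ln n} = d-1 \quad\text{and}\quad \limsup_{n\to\infty} \frac{W_n}{\ln\ln n} = d; \] in particular $W_n = \Theta(\ln\ln n)$ almost surely.
   Context: Fix an integer $d \ge 1$. Let $X^{(1)}, X^{(2)}, \dots$ be i.i.d. random vectors in $\mathbb{R}^d$ with independent Exponential$(1)$ coordinates. For $x,y \in \mathbb{R}^d$ write $x \prec y$ if $x_j<y_j$ for all $j$, $x \le y$ if $x_j \le y_j$ for all $j$, and $x_+ := \sum_j x_j$. The record-setting region at time $n$ is $\mathrm{RS}_n := \{x \in \mathbb{R}^d : 0 \le x,\ x \not\prec X^{(i)} \text{ for all } 1 \le i \le n\}$, and its frontier $F_n$ is the topological boundary of $\mathrm{RS}_n$ relative to $[0,\infty)^d$. Define $F_n^- := \min\{x_+ : x \in F_n\}$, $F_n^+ := \max\{x_+ : x \in F_n\}$, and the width $W_n := F_n^+ - F_n^-$. *)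

(* Defs.v *)
From HB Require Import structures.
From mathcomp Require Import all_boot all_order all_algebra.
From mathcomp Require Import all_classical all_reals all_analysis.
Set Implicit Arguments. Unset Strict Implicit. Unset Printing Implicit Defensive.
Import Order.TTheory GRing.Theory Num.Theory.
Import numFieldNormedType.Exports.
Local Open Scope classical_set_scope.
Local Open Scope ring_scope.

Definition mutually_independent (R : realType) (dT : measure_display)
  (T : measurableType dT) (P : probability T R) (I : eqType)
  (Y : I -> {RV P >-> R}) : Prop :=
  forall (s : seq I) (B : I -> set R), uniq s ->
    (forall i, i \in s -> measurable (B i)) ->
    P [set w | forall i, i \in s -> B i (Y i w)] =
    (\big[*%E/1%E]_(i <- s) P (Y i @^-1` B i))%E.

Definition strictly_below (R : realType) (d : nat) (x y : 'rV[R]_d) : Prop :=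
  forall j : 'I_d, x ord0 j < y ord0 j.

Definition orthant (R : realType) (d : nat) : set 'rV[R]_d :=
  [set x | forall j : 'I_d, 0 <= x ord0 j].

(* record-setting region after n observations pts 0, ..., pts (n-1)
   (pts i is the paper's X^(i+1)) *)
Definition RS (R : realType) (d : nat) (pts : nat -> 'rV[R]_d) (n : nat)
  : set 'rV[R]_d :=
  [set x | @orthant R d x /\ forall i, (i < n)%N -> ~ strictly_below x (pts i)].

Definition rel_boundary (R : realType) (d : nat) (Y A : set 'rV[R]_d)
  : set 'rV[R]_d :=
  Y `&` closure A `&` closure (Y `\` A).

Definition frontier (R : realType) (d : nat) (pts : nat -> 'rV[R]_d) (n : nat) :=
  rel_boundary (@orthant R d) (RS pts n).

Definition coord_sum (R : realType) (d : nat) (x : 'rV[R]_d) : R :=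
  \sum_(j < d) x ord0 j.

(* F_n^- and F_n^+ (min and max are attained since F_n is compact,
   so inf/sup coincide with min/max for n >= 1) *)
Definition Fminus (R : realType) (d : nat) (pts : nat -> 'rV[R]_d) (n : nat) : R :=
  inf [set coord_sum x | x in frontier pts n].
Definition Fplus (R : realType) (d : nat) (pts : nat -> 'rV[R]_d) (n : nat) : R :=
  sup [set coord_sum x | x in frontier pts n].

Definition sample (R : realType) (dT : measure_display) (T : measurableType dT)
  (P : probability T R) (d : nat) (X : nat -> 'I_d -> {RV P >-> R}) (w : T)
  : nat -> 'rV[R]_d :=
  fun i => \row_(j < d) X i j w.

Definition width (R : realType) (dT : measure_display) (T : measurableType dT)
  (P : probability T R) (d : nat) (X : nat -> 'I_d -> {RV P >-> R}) (n : nat)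
  (w : T) : R :=
  Fplus (sample X w) n - Fminus (sample X w) n.

(* Main.v *)
Require Import Defs.
From HB Require Import structures.
From mathcomp Require Import all_boot all_order all_algebra.
From mathcomp Require Import all_classical all_reals all_analysis.
From mathcomp Require Import measurable_realfun lra ring zify.
Set Implicit Arguments. Unset Strict Implicit. Unset Printing Implicit Defensive.
Import Order.TTheory GRing.Theory Num.Theory.
Import numFieldNormedType.Exports.
Local Open Scope classical_set_scope.
Local Open Scope ring_scope.
Local Open Scope measure_scope.

(* [Fplus] is the largest coordinate sum of a positive observation, and [c <= Fminus]
   holds exactly when every point of the orthant with coordinate sum below [c] is
   dominated by an observation. An observation lies above [x >= 0] with probability
   [exp (- x_+)]; covering and packing [{x > 0 | t < x_+}] by boxes shows that its
   coordinate sum exceeds [t] with probability of order [t ^ (d - 1) * exp (- t)].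
   At [t = ln n + s * lnln n] one has [n * exp (- t) = (ln n) ^ (- s)], so all
   deviation probabilities are bounded by powers of [ln n]: [Fminus] stays within
   [e * lnln n] of [ln n], [Fplus] is at least [ln n + (d - 1 - e) * lnln n], and it
   exceeds [ln n + s * lnln n] with probability of order [(ln n) ^ (d - 1 - s)]. The
   latter tends to [0] for [s > d - 1] and is summable along the powers of two for
   [s > d]; monotonicity in [n] fills the gaps between powers of two. The value [d] of
   the limit superior is attained because the [n]-th observation itself has coordinate
   sum larger than [ln n + d * lnln n] with probability of order [1 / (n * ln n)],
   which is not summable. *)

Section frontier_geometry.
Context {R : realType} {d : nat}.
Implicit Types (x y : 'rV[R]_d) (pts : nat -> 'rV[R]_d) (n k : nat) (c : R)
  (p : {ffun 'I_d -> nat}).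

Lemma coord_sum_continuous : continuous (@coord_sum R d).
Proof.
apply: (@continuous_big _ _ +%R 0 xpredT) => [|j _].
  by move=> xy; exact: add_continuous.
exact: coord_continuous.
Qed.

Lemma coord_sumD x y : coord_sum (x + y) = coord_sum x + coord_sum y.
Proof. by rewrite /coord_sum -big_split; apply: eq_bigr => j _; rewrite mxE. Qed.

Lemma coord_sumZ (t : R) x : coord_sum (t *: x) = t * coord_sum x.
Proof. by rewrite /coord_sum mulr_sumr; apply: eq_bigr => j _; rewrite mxE. Qed.

Lemma coord_sum0 : coord_sum (0 : 'rV[R]_d) = 0.
Proof. by rewrite /coord_sum big1// => j _; rewrite mxE. Qed.

Lemma coord_sum_ge0 x : orthant x -> 0 <= coord_sum x.
Proof. by move=> x0; apply: sumr_ge0 => j _; exact: x0. Qed.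

Lemma coord_sum_le x y : (forall j, x ord0 j <= y ord0 j) ->
  coord_sum x <= coord_sum y.
Proof. by move=> xy; apply: ler_sum. Qed.

Lemma orthant0 : orthant (0 : 'rV[R]_d).
Proof. by move=> j; rewrite mxE. Qed.

Lemma orthant_convex x y (t : R) : 0 <= t <= 1 -> orthant x -> orthant y ->
  orthant (t *: x + (1 - t) *: y).
Proof.
move=> /andP[t0 t1] x0 y0 j.
by rewrite !mxE addr_ge0// mulr_ge0 ?subr_ge0.
Qed.

Lemma open_strictly_below y : open [set x | strictly_below x y].
Proof.
rewrite openE => x xy; rewrite /interior.
apply: (@filter_forall _ _ (fun j (z : 'rV[R]_d) => z ord0 j < y ord0 j) _
  (nbhs_filter x)) => j.
exact: (coord_continuous (lt_nbhsl (xy j))).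
Qed.

Definition dominated pts n : set 'rV[R]_d :=
  \bigcup_(i in [set i | (i < n)%N]) [set x | strictly_below x (pts i)].

Lemma open_dominated pts n : open (dominated pts n).
Proof. by apply: bigcup_open => i _; exact: open_strictly_below. Qed.

Lemma dominated_nondecreasing pts n m : (n <= m)%N ->
  dominated pts n `<=` dominated pts m.
Proof. by move=> nm x [i /= ilt xi]; exists i => //=; exact: leq_trans nm. Qed.

Lemma dominatedW pts n x y : (forall j, x ord0 j <= y ord0 j) ->
  dominated pts n y -> dominated pts n x.
Proof. by move=> xy [i ilt yi]; exists i => // j; exact: le_lt_trans (yi j). Qed.

Lemma RS_E pts n : RS pts n = @orthant R d `\` dominated pts n.
Proof.
apply/seteqP; split=> x -[x0 nx]; split=> //.
  by move=> [i ilt xi]; exact: nx ilt xi.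
by move=> i ilt xi; apply: nx; exists i.
Qed.

Lemma frontierE pts n : frontier pts n =
  (@orthant R d `\` dominated pts n) `&` closure (@orthant R d `&` dominated pts n).
Proof.
rewrite /frontier /rel_boundary RS_E setDD; apply/seteqP; split=> x.
  move=> [[x0 cx] dx]; split=> //; split=> // ndx.
  have [z [[_ +] dz]] := cx _ (open_nbhs_nbhs (conj (@open_dominated pts n) ndx)).
  exact.
by move=> [[x0 nx] dx]; split=> //; split=> //; exact: subset_closure.
Qed.

Lemma connected_meets_frontier pts n (C : set 'rV[R]_d) : connected C ->
  C `<=` @orthant R d -> C `&` dominated pts n !=set0 ->
  C `\` dominated pts n !=set0 -> C `&` frontier pts n !=set0.
Proof.
move=> conC C0 Cdom [z [Cz ndz]]; apply/set0P/eqP => CF0.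
suff CD : C `&` dominated pts n = C by move: Cz; rewrite -CD => -[_ /ndz].
apply: conC Cdom _ _; first by exists (dominated pts n) => //; exact: open_dominated.
exists (closure (@orthant R d `&` dominated pts n)); first exact: closed_closure.
apply/seteqP; split=> x [Cx dx]; split=> //.
  by apply: subset_closure; split=> //; exact: C0.
apply: contrapT => ndx; suff : set0 x by [].
by rewrite -CF0 frontierE; split=> //; split=> //; split=> //; exact: C0.
Qed.

Lemma segment_meets_frontier pts n x y : orthant x -> orthant y ->
  dominated pts n x -> ~ dominated pts n y ->
  exists2 t : R, 0 <= t <= 1 & frontier pts n (x + t *: (y - x)).
Proof.
move=> x0 y0 dx ndy; pose g t : 'rV[R]_d := x + t *: (y - x).
have cg : continuous g.
  move=> t; apply: cvgD; first exact: cvg_cst.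
  exact: scalel_continuous.
have conn : connected (g @` `[0, 1]).
  apply: connected_continuous_connected; first exact: segment_connected.
  exact: continuous_subspaceT.
have [|||z [[t /= t01 <-] gt]] := connected_meets_frontier (pts := pts) (n := n) conn.
- move=> _ [t /= + <-]; rewrite in_itv/= => t01 j.
  have -> : g t = t *: y + (1 - t) *: x.
    by rewrite /g scalerBr scalerBl scale1r addrCA addrA.
  exact: orthant_convex.
- exists x; split=> //; exists 0; first by rewrite /= in_itv/= lexx ler01.
  by rewrite /g scale0r addr0.
- exists y; split=> //; exists 1; first by rewrite /= in_itv/= ler01 lexx.
  by rewrite /g scale1r addrC subrK.
by exists t; rewrite // -[_ && _]/(t \in `[0, 1]).
Qed.

Lemma exists_undominated_ge pts n x : (0 < d)%N ->
  exists2 y : 'rV_d, (forall j, x ord0 j <= y ord0 j) & ~ dominated pts n y.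
Proof.
move=> d0; pose j0 := Ordinal d0.
pose K := \sum_(i < n) `|pts i ord0 j0 - x ord0 j0|.
exists (\row_j (x ord0 j + K) : 'rV_d) => [j|[i /= ilt /(_ j0)]].
  by rewrite mxE lerDl sumr_ge0.
apply/negP; rewrite mxE -leNgt -lerBlDl (le_trans (ler_norm _))//.
by rewrite /K (bigD1 (Ordinal ilt))//= lerDl sumr_ge0.
Qed.

Lemma frontier_coord_sum_gt pts n x c : frontier pts n x -> c < coord_sum x ->
  exists i, [/\ (i < n)%N, strictly_below 0 (pts i) & c < coord_sum (pts i)].
Proof.
rewrite frontierE => -[_ clx] cx.
have nx : nbhs x [set z | c < coord_sum z].
  exact: (coord_sum_continuous (lt_nbhsr cx)).
have [z [[z0 [i ilt zi]] cz]] := clx _ nx.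
exists i; split=> //.
- by move=> j; rewrite mxE; exact: le_lt_trans (z0 j) (zi j).
- by apply: lt_le_trans cz _; apply: coord_sum_le => j; exact/ltW/zi.
Qed.

Lemma has_ubound_frontier pts n :
  has_ubound [set coord_sum x | x in frontier pts n].
Proof.
exists (\sum_(i < n) `|coord_sum (pts i)|) => _ [x Fx <-].
rewrite leNgt; apply/negP => /(frontier_coord_sum_gt Fx)[i [ilt _]].
apply/negP; rewrite -leNgt (le_trans (ler_norm _))//.
by rewrite (bigD1 (Ordinal ilt))//= lerDl sumr_ge0.
Qed.

Lemma frontier_coord_sum_ge0 pts n x : frontier pts n x -> 0 <= coord_sum x.
Proof. by rewrite frontierE => -[[x0 _] _]; exact: coord_sum_ge0. Qed.

Lemma Fplus_ge0 pts n : 0 <= Fplus pts n.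
Proof.
rewrite /Fplus; have [->|/set0P[_ [x Fx _]]] :=
  eqVneq [set coord_sum x | x in frontier pts n] set0; first by rewrite sup0.
apply: le_trans (frontier_coord_sum_ge0 Fx) _.
by apply: ub_le_sup; [exact: has_ubound_frontier|exists x].
Qed.

Lemma Fminus_ge0 pts n : 0 <= Fminus pts n.
Proof.
rewrite /Fminus; have [->|/set0P F0] :=
  eqVneq [set coord_sum x | x in frontier pts n] set0; first by rewrite inf0.
by apply: lb_le_inf => // _ [x Fx <-]; exact: frontier_coord_sum_ge0 Fx.
Qed.

Lemma coord_sum_le_Fplus pts n x : (0 < d)%N -> orthant x -> dominated pts n x ->
  coord_sum x <= Fplus pts n.
Proof.
move=> d0 x0 dx; have [y xy ndy] := exists_undominated_ge pts n x d0.
have [|t /andP[t0 _] Ft] := segment_meets_frontier x0 _ dx ndy.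
  by move=> j; exact: le_trans (xy j).
apply: le_trans (ub_le_sup (has_ubound_frontier pts n) (imageP _ Ft)).
by apply: coord_sum_le => j; rewrite !mxE lerDl mulr_ge0// subr_ge0; exact: xy.
Qed.

Lemma Fminus_le_coord_sum pts n x : orthant x -> dominated pts n 0 ->
  ~ dominated pts n x -> Fminus pts n <= coord_sum x.
Proof.
move=> x0 d0 ndx; have [t /andP[t0 t1]] := segment_meets_frontier orthant0 x0 d0 ndx.
rewrite subr0 add0r => Ft; apply: (@le_trans _ _ (coord_sum (t *: x))).
  apply: ge_inf; last exact: imageP.
  by exists 0 => _ [y Fy <-]; exact: frontier_coord_sum_ge0 Fy.
by rewrite coord_sumZ ler_piMl// coord_sum_ge0.
Qed.

Lemma Fplus_gtP pts n c : (0 < d)%N -> 0 <= c ->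
  c < Fplus pts n <->
  exists i, [/\ (i < n)%N, strictly_below 0 (pts i) & c < coord_sum (pts i)].
Proof.
move=> d0 c0; split.
  rewrite /Fplus; have [->|/set0P F0] :=
    eqVneq [set coord_sum x | x in frontier pts n] set0.
    by rewrite sup0 ltNge c0.
  by move=> /(sup_gt F0)[_ [x Fx <-]]; exact: frontier_coord_sum_gt.
move=> [i [ilt pi ci]]; set S := coord_sum (pts i) in ci.
(* a dominated point on the ray to [pts i], still with coordinate sum above [c] *)
pose t := (1 + c / S) / 2; have S0 : 0 < S by exact: le_lt_trans ci.
have cS : c / S < 1 by rewrite ltr_pdivrMr// mul1r.
have t0 : 0 < t by have := divr_ge0 c0 (ltW S0); rewrite /t; lra.
have p0 j : 0 < pts i ord0 j by have := pi j; rewrite mxE.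
have tp0 : orthant (t *: pts i) by move=> j; rewrite mxE mulr_ge0// ltW.
have dt : dominated pts n (t *: pts i).
  by exists i => // j; rewrite mxE gtr_pMl// /t; lra.
apply: lt_le_trans (coord_sum_le_Fplus d0 tp0 dt).
by rewrite coord_sumZ -ltr_pdivrMr// -/S /t; lra.
Qed.

Lemma Fminus_geP pts n c : (0 < d)%N -> 0 < c ->
  c <= Fminus pts n <->
  forall x, orthant x -> coord_sum x < c -> dominated pts n x.
Proof.
move=> d0 c0; split.
  rewrite /Fminus; have [->|/set0P[_ [z Fz _]]] :=
    eqVneq [set coord_sum x | x in frontier pts n] set0.
    by rewrite inf0 leNgt c0.
  move=> cF x x0 xc; apply: contrapT => ndx.
  have d00 : dominated pts n 0.
    have [|i [ilt pi _]] := frontier_coord_sum_gt (c := coord_sum z - 1) Fz; first lra.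
    by exists i.
  by have := Fminus_le_coord_sum x0 d00 ndx; apply/negP; rewrite -ltNge (lt_le_trans xc).
move=> dom; have d00 : dominated pts n 0.
  by apply: dom; rewrite ?coord_sum0//; exact: orthant0.
apply: lb_le_inf.
  have [y y0 ndy] := exists_undominated_ge pts n 0 d0.
  have [|t _ Ft] := segment_meets_frontier orthant0 _ d00 ndy.
    by move=> j; apply: le_trans (y0 j); rewrite mxE.
  by eexists; exact: imageP Ft.
move=> _ [x + <-]; rewrite frontierE => -[[x0 ndx] _].
by rewrite leNgt; apply/negP => /(dom _ x0).
Qed.

Lemma Fplus_nondecreasing pts : (0 < d)%N -> nondecreasing_seq (Fplus pts).
Proof.
move=> d0 n m nm; rewrite leNgt; apply/negP.
move=> /(Fplus_gtP pts n d0 (Fplus_ge0 _ _))[i [ilt pi mi]].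
suff : Fplus pts m < Fplus pts m by rewrite ltxx.
apply/(Fplus_gtP pts m d0 (Fplus_ge0 _ _)).
by exists i; split=> //; exact: leq_trans nm.
Qed.

Lemma Fminus_nondecreasing pts : (0 < d)%N -> nondecreasing_seq (Fminus pts).
Proof.
move=> d0 n m nm; have := Fminus_ge0 pts n; rewrite le_eqVlt => /predU1P[<-|n0].
  exact: Fminus_ge0.
apply/Fminus_geP => // x x0 xn; apply: dominated_nondecreasing nm _ _.
by move: x x0 xn; apply/Fminus_geP.
Qed.

Definition grid_point k p : 'rV[R]_d :=
  \row_j ((p j)%:R / k.+1%:R).

Lemma orthant_grid_point k p : orthant (grid_point k p).
Proof. by move=> j; rewrite mxE divr_ge0. Qed.

Definition grid_round_up k x : {ffun 'I_d -> nat} :=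
  [ffun j => (Num.truncn (x ord0 j * k.+1%:R)).+1].

Lemma grid_round_up_gt k x : strictly_below x (grid_point k (grid_round_up k x)).
Proof. by move=> j; rewrite mxE ltr_pdivlMr// ffunE truncnS_gt. Qed.

Lemma coord_sum_grid_round_up k x : orthant x ->
  coord_sum (grid_point k (grid_round_up k x)) <= coord_sum x + d%:R / k.+1%:R.
Proof.
move=> x0; rewrite [d%:R / _](_ : _ = \sum_(j < d) k.+1%:R^-1); last first.
  by rewrite sumr_const card_ord mulr_natl.
rewrite -big_split; apply: ler_sum => j _ /=.
rewrite mxE ffunE -natr1 mulrDl mul1r lerD2r ler_pdivrMr// truncn_le.
by rewrite mulr_ge0// x0.
Qed.

Lemma Fminus_grid_geP pts n c : (0 < d)%N -> 0 < c ->
  c <= Fminus pts n <->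
  forall k p, coord_sum (grid_point k p) < c -> dominated pts n (grid_point k p).
Proof.
move=> d0 c0; split=> [/Fminus_geP-/(_ d0 c0) dom k p|dom].
  by apply: dom; exact: orthant_grid_point.
apply/Fminus_geP => // x x0 xc; have cx0 : 0 < c - coord_sum x by rewrite subr_gt0.
pose k := Num.truncn (d%:R / (c - coord_sum x)).
have dk : d%:R / k.+1%:R < c - coord_sum x.
  by rewrite ltr_pdivrMr// mulrC -ltr_pdivrMr//; exact: truncnS_gt.
apply: (@dominatedW _ _ _ (grid_point k (grid_round_up k x))).
  by move=> j; exact/ltW/grid_round_up_gt.
by apply: dom; apply: le_lt_trans (coord_sum_grid_round_up k x0) _; rewrite -ltrBrDl.
Qed.

End frontier_geometry.

Lemma exists_nat_lt_le (R : realType) (x : R) : 0 < x ->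
  exists n : nat, n%:R < x <= n.+1%:R.
Proof.
move=> x0; have exN : exists n : nat, x <= n.+1%:R.
  by exists (Num.truncn x); exact/ltW/truncnS_gt.
case: (ex_minnP exN) => -[|n] xn minn; first by exists 0; rewrite x0.
exists n.+1; rewrite xn andbT ltNge; apply/negP => /minn.
by rewrite ltnn.
Qed.

Section staircase.
Context {R : realType} {d' b : nat}.
Implicit Types (t : R) (z : {ffun 'I_d' -> 'I_b.+1}) (x : 'rV[R]_d'.+1).

(* The corners used to cover [{x > 0 | t < x_+}] up to a translation: every
   coordinate but the first lies on the integer grid, and the first one makes up
   for the rest of [t]. *)
Definition staircase t z : 'rV[R]_d'.+1 :=
  \row_j if unlift ord0 j is Some k then (z k)%:R else Num.max 0 (t - \sum_k (z k)%:R).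

Lemma orthant_staircase t z : orthant (staircase t z).
Proof. by move=> j; rewrite mxE; case: unlift => [k|] //; rewrite le_max lexx. Qed.

Lemma coord_sum_staircase_ge t z : t <= coord_sum (staircase t z).
Proof.
rewrite /coord_sum big_ord_recl mxE unlift_none -lerBlDr.
under eq_bigr do rewrite mxE liftK.
by rewrite le_max lexx orbT.
Qed.

Lemma exists_staircase_below t x : strictly_below 0 x ->
  t + d'%:R < coord_sum x -> t <= b%:R -> exists z, strictly_below (staircase t z) x.
Proof.
move=> x0 tx tb; have xp j : 0 < x ord0 j by have := x0 j; rewrite mxE.
have [u ux] := choice (fun k => exists_nat_lt_le (xp (lift ord0 k))).
exists [ffun k => inord (minn b (u k))] => j; rewrite mxE.
have zE k : ([ffun k => inord (minn b (u k))] : {ffun 'I_d' -> 'I_b.+1}) k =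
    minn b (u k) :> nat.
  by rewrite ffunE inordK ?ltnS ?geq_minl.
case: unliftP => [k|] ->.
  have /andP[+ _] := ux k; apply: le_lt_trans.
  by rewrite zE ler_nat geq_minr.
rewrite gt_max xp ltrBlDr; under eq_bigr do rewrite zE.
have [/existsP[k bu]|/existsPn ub] := boolP [exists k, (b <= u k)%N].
  rewrite (bigD1 k)//= (minn_idPl bu); apply: le_lt_trans tb _.
  by rewrite addrCA ltrDl ltr_pwDl// sumr_ge0.
rewrite -(ltrD2r d'%:R) (lt_le_trans tx)// /coord_sum big_ord_recl -addrA lerD2l.
rewrite [d'%:R](_ : _ = \sum_(k < d') 1); last by rewrite sumr_const card_ord.
rewrite -big_split; apply: ler_sum => k _ /=.
have /minn_idPr -> : (u k <= b)%N by rewrite ltnW// ltnNge ub.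
by rewrite natr1; have /andP[] := ux k.
Qed.

End staircase.

Section join_and_two_coord.
Context {R : realType} {d : nat}.
Implicit Types (x y : 'rV[R]_d) (pts : nat -> 'rV[R]_d) (j : 'I_d) (p q : R).

Definition join_point x y : 'rV[R]_d := \row_j Num.max (x ord0 j) (y ord0 j).

Lemma orthant_join_point x y : orthant x -> orthant (join_point x y).
Proof. by move=> x0 j; rewrite mxE le_max x0. Qed.

Lemma coord_sum_join_pointC x y :
  coord_sum (join_point x y) = coord_sum (join_point y x).
Proof. by apply: eq_bigr => j _; rewrite !mxE maxC. Qed.

(* Pigeonhole: either distinct observations lie above the [m] points, or one observation
   lies above two of them, hence above their join. *)
Lemma all_dominated_injective_or_join pts n m (x : 'I_m -> 'rV[R]_d) :
  (forall a, dominated pts n (x a)) ->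
  (exists2 f : {ffun 'I_m -> 'I_n}, injective f &
     forall a, strictly_below (x a) (pts (f a))) \/
  (exists a b (i : 'I_n), a != b /\ strictly_below (join_point (x a) (x b)) (pts i)).
Proof.
move=> dom; have below a : exists i : 'I_n, strictly_below (x a) (pts i).
  by have [i ilt xi] := dom a; exists (Ordinal ilt).
have [f xf] := choice below; have [injf|] := pselect (injective f).
  left; exists [ffun a => f a] => [a b|a]; rewrite !ffunE; first exact: injf.
  exact: xf.
move=> /existsNP[a /existsNP[b /not_implyP[fab /eqP ab]]]; right.
exists a, b, (f a); split=> // j; rewrite mxE gt_max; apply/andP; split; first exact: xf.
by rewrite fab; exact: xf.
Qed.

Definition two_coord j j' p q : 'rV[R]_d :=
  p *: delta_mx ord0 j + q *: delta_mx ord0 j'.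

Lemma orthant_two_coord j j' p q : 0 <= p -> 0 <= q -> orthant (two_coord j j' p q).
Proof. by move=> p0 q0 k; rewrite !mxE addr_ge0// mulr_ge0. Qed.

Lemma coord_sum_delta j : coord_sum (delta_mx ord0 j : 'rV[R]_d) = 1.
Proof.
rewrite /coord_sum (bigD1 j)//= mxE !eqxx big1 ?addr0// => k /negbTE kj.
by rewrite mxE kj andbF.
Qed.

Lemma coord_sum_two_coord j j' p q : coord_sum (two_coord j j' p q) = p + q.
Proof. by rewrite coord_sumD !coord_sumZ !coord_sum_delta !mulr1. Qed.

Lemma coord_sum_join_two_coord j j' p q p' q' : j != j' -> 0 <= p' -> 0 <= q ->
  p' + q <= coord_sum (join_point (two_coord j j' p q) (two_coord j j' p' q')).
Proof.
move=> jj' p'0 q0; rewrite -(coord_sum_two_coord j j'); apply: coord_sum_le => k.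
rewrite !mxE !eqxx /= le_max; have [->|kj] := eqVneq k j.
  by rewrite (negbTE jj') !mulr1 !mulr0 !addr0 lexx orbT.
by rewrite !mulr0 !add0r lexx.
Qed.

End join_and_two_coord.

Section outer_measure.
Context {R : realType} {dT : measure_display} {T : measurableType dT}.

Lemma outer_measure_bigcup_fin (mu : {outer_measure set T -> \bar R}) (I : finType)
    (A : I -> set T) (b : R) : (forall i, (mu (A i) <= b%:E)%E) ->
  (mu (\bigcup_i A i) <= (#|I|%:R * b)%:E)%E.
Proof.
move=> Ab; have -> : \bigcup_i A i = \big[setU/set0]_(i <- enum I) A i.
  rewrite -bigcup_seq; apply/seteqP; split=> w [i _ Aw]; exists i => //=.
  by rewrite mem_enum.
rewrite cardE mulr_natl.
elim: (enum I) => [|i s IH]; first by rewrite big_nil outer_measure0 mulr0n.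
by rewrite big_cons/= mulrS EFinD (le_trans (outer_measureU2 _ _ _)) ?leeD.
Qed.

Variable mu : {measure set T -> \bar R}.

Lemma measure_bigcup_fin (I : finType) (A : I -> set T) :
  (forall i, measurable (A i)) -> trivIset setT A ->
  mu (\bigcup_i A i) = (\sum_i mu (A i))%E.
Proof.
move=> mA tA; rewrite measure_fin_bigcup//; last exact: finite_finset.
rewrite -[RHS]big_enum/= (fsbigE _ _ (enum_uniq I))//.
  by apply: eq_bigl => i; rewrite in_setT.
by move=> i _; rewrite mem_enum.
Qed.

Lemma exists_measurable_superset (A : set T) (x : \bar R) : (mu^* A < x)%E ->
  exists B, [/\ measurable B, A `<=` B & (mu B < x)%E].
Proof.
move=> /ereal_inf_lt[_ [F [mF AF] <-] Fx]; exists (\bigcup_k F k).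
split=> //; first exact: bigcupT_measurable.
apply: le_lt_trans Fx; apply: measure_sigma_subadditive => //.
exact: bigcupT_measurable.
Qed.

Lemma negligible_outer_measure0 (A : set T) : mu^* A = 0%E -> mu.-negligible A.
Proof.
move=> A0; have cover (k : nat) : exists B,
    [/\ measurable B, A `<=` B & (mu B < k.+1%:R^-1%:E)%E].
  by apply: exists_measurable_superset; rewrite A0 lte_fin invr_gt0.
have [B coverB] := choice cover.
exists (\bigcap_k B k); split.
- by apply: bigcapT_measurable => k; have [] := coverB k.
- apply/eqP; rewrite eq_le measure_ge0 andbT; apply/lee_addgt0Pr => e e0.
  rewrite add0e; have [k] := near_infty_natSinv_lt (PosNum e0).
  move=> _ /(_ k (leqnn k))/ltW ke; have [mB _ Bk] := coverB k.
  apply: le_trans (ltW (lt_le_trans Bk _)); last by rewrite lee_fin.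
  apply: le_measure; rewrite ?inE//; last exact: bigcap_inf.
  by apply: bigcapT_measurable => i; have [] := coverB i.
- by move=> w Aw k _; have [_ + _] := coverB k; exact.
Qed.

Lemma borel_cantelli (A : nat -> set T) : (\sum_(k <oo) mu^* (A k) < +oo)%E ->
  {ae mu, forall w, \forall k \near \oo, ~ A k w}.
Proof.
move=> sumA; suff : mu^* (lim_sup_set A) = 0%E.
  move=> /negligible_outer_measure0; apply: negligibleS => w /= nA n _.
  apply: contrapT => nAn; apply: nA; exists n => // k /= nk Akw.
  by apply: nAn; exists k.
apply/eqP; rewrite eq_le outer_measure_ge0 andbT.
have /cvg_lim <- // : (\sum_(n <= k <oo) mu^* (A k))%E @[n --> \oo] --> 0%E.
  by apply: nneseries_tail_cvg => // k _; exact: outer_measure_ge0.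
apply: lime_ge.
  apply/cvg_ex; exists 0%E; apply: nneseries_tail_cvg => // k _.
  exact: outer_measure_ge0.
apply: nearW => n; apply: le_trans (outer_measure_sigma_subadditive_tail _ _ _).
by apply: le_outer_measure; rewrite setC_I; exact: bigcap_inf.
Qed.

End outer_measure.

Definition infinitely_often (A : nat -> Prop) :=
  forall N, exists2 n, (N <= n)%N & A n.

Lemma infinitely_often_near (A B C : nat -> Prop) : infinitely_often A ->
  (\forall n \near \oo, B n) -> (forall n, A n -> B n -> C n) ->
  infinitely_often C.
Proof.
move=> ioA [M _ MB] ABC N; have [n] := ioA (maxn N M).
rewrite geq_max => /andP[Nn Mn] An; exists n => //.
by apply: ABC => //; exact: MB.
Qed.

Section vanishing.
Context {R : realType} {dT : measure_display} {T : measurableType dT}.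
Variable P : probability T R.
Implicit Types A B : nat -> set T.

Lemma outer_probabilityE (E : set T) : measurable E -> P^* E = P E.
Proof. exact: measurable_mu_extE. Qed.

Definition vanishing A := P^* (A n) @[n --> \oo] --> 0%E.

Lemma vanishingS A B : (\forall n \near \oo, A n `<=` B n) ->
  vanishing B -> vanishing A.
Proof.
move=> AB; apply: squeeze_cvge; last exact: cvg_cst.
by apply: filterS AB => n AB; rewrite outer_measure_ge0 le_outer_measure.
Qed.

Lemma vanishingU A B : vanishing A -> vanishing B ->
  vanishing (fun n => A n `|` B n).
Proof.
move=> vA vB; apply: (@squeeze_cvge _ _ _ _ (fun=> 0%E) _
    (fun n => P^* (A n) + P^* (B n))%E); last 2 first.
- exact: cvg_cst.
- by rewrite -[X in _ --> X]adde0; apply: cvgeD.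
by apply: nearW => n; rewrite outer_measure_ge0 outer_measureU2.
Qed.

Lemma vanishing_ae A : vanishing A ->
  {ae P, forall w, infinitely_often (fun n => ~ A n w)}.
Proof.
move=> vA; apply: ae_foralln => N.
apply: (@negligibleS _ _ _ _ (\bigcap_(n in [set n | (N <= n)%N]) A n)).
  by move=> w /= nio n Nn; apply: contrapT => nA; apply: nio; exists n.
apply: negligible_outer_measure0; apply/eqP.
rewrite eq_le outer_measure_ge0 andbT -(cvg_lim _ vA)//.
apply: lime_ge; first by apply/cvg_ex; exists 0%E.
near=> n; apply: le_outer_measure; apply: bigcap_inf.
by near: n; exact: nbhs_infty_ge.
Unshelve. all: by end_near. Qed.

End vanishing.

Section independence.
Context {R : realType} {dT : measure_display} {T : measurableType dT}.
Variable P : probability T R.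

Definition independent_systems (I : eqType) (G : I -> set_system T) :=
  forall (s : seq I) (A : I -> set T), uniq s ->
    (forall i, i \in s -> G i (A i)) ->
  P (\big[setI/setT]_(i <- s) A i) = (\prod_(i <- s) P (A i))%E.

Lemma measurable_bigsetI (I : eqType) (s : seq I) (A : I -> set T) :
  (forall i, i \in s -> measurable (A i)) ->
  measurable (\big[setI/setT]_(i <- s) A i).
Proof.
move=> mA; rewrite big_seq; apply: big_ind => // B C mB mC.
exact: measurableI.
Qed.

Section generated.
Variables (I : eqType) (G : I -> set_system T).
Hypotheses (indepG : independent_systems G)
  (mG : forall i, G i `<=` measurable) (GI : forall i, setI_closed (G i))
  (GT : forall i, G i setT).

Let measurable_generated i A : <<s G i >> A -> measurable A.
Proof. by apply: smallest_sub => //; exact: sigma_algebra_measurable. Qed.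

(* The product rule is extended to one more index at a time: as functions of the
   event attached to that index, both sides are finite measures. *)
Lemma independent_generated_cat (s s' : seq I) (A : I -> set T) : uniq (s ++ s') ->
  (forall i, i \in s -> <<s G i >> (A i)) -> (forall i, i \in s' -> G i (A i)) ->
  P (\big[setI/setT]_(i <- s ++ s') A i) = (\prod_(i <- s ++ s') P (A i))%E.
Proof.
elim: s s' A => [|a s IH] s' A; first by move=> us' _; exact: indepG.
rewrite cat_cons cons_uniq => /andP[ass' uss'] sA s'A.
pose E := \big[setI/setT]_(i <- s ++ s') A i.
have sA' i : i \in s -> <<s G i >> (A i).
  by move=> si; apply: sA; rewrite in_cons si orbT.
have mE : measurable E.
  apply: measurable_bigsetI => i; rewrite mem_cat => /orP[/sA'|/s'A].
    exact: measurable_generated.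
  exact: mG.
have PE : P E = (\prod_(i <- s ++ s') P (A i))%E by exact: IH.
have E0 : 0 <= fine (P E) by exact: fine_ge0.
have agree B : G a B -> mrestr P mE B = mscale (NngNum E0) P B.
  move=> GB; pose A' i := if i == a then B else A i.
  have A'a : A' a = B by rewrite /A' eqxx.
  have AA' i : i \in s ++ s' -> A' i = A i.
    by rewrite /A'; case: eqP => // ->; rewrite (negbTE ass').
  have as' : perm_eq (s ++ a :: s') (a :: s ++ s') by rewrite -cat1s perm_catCA.
  have := IH (a :: s') A'; rewrite (perm_uniq as') cons_uniq ass' uss'.
  rewrite !(perm_big _ as')/= !big_cons A'a.
  rewrite [in LHS](eq_big_seq _ AA').
  under [X in (_ * X)%E]eq_big_seq do rewrite AA'//.
  rewrite -PE /mrestr /mscale/= fineK ?fin_num_measure// [RHS]muleC; apply=> // i.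
    by move=> si; rewrite AA' ?mem_cat ?si//; exact: sA'.
  rewrite in_cons => /predU1P[->|s'i]; first by rewrite A'a.
  by rewrite AA' ?mem_cat ?s'i ?orbT//; exact: s'A.
rewrite !big_cons -PE -/E.
have cover : \bigcup_(k : nat) setT = setT :> set T by rewrite bigcup_const.
have finE (k : nat) : (mrestr P mE setT < +oo)%E.
  by rewrite /mrestr setTI (le_lt_trans (probability_le1 P mE))// ltry.
have -> : P (A a `&` E) = mscale (NngNum E0) P (A a).
  exact: (g_sigma_algebra_measure_unique (G a) (mG (i := a)) (fun=> setT) (fun=> GT a)
    cover (mrestr P mE) (mscale (NngNum E0) P) (GI (i := a)) agree finE
    (A a) (sA a (mem_head _ _))).
by rewrite /mscale/= fineK ?fin_num_measure// muleC.
Qed.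

Lemma independent_generated : independent_systems (fun i => <<s G i >>).
Proof.
move=> s A us sA; have := @independent_generated_cat s [::] A.
by rewrite cats0; exact.
Qed.

End generated.

Lemma independent_avoid_ub (I : eqType) (G : I -> set_system T) (s : seq I)
    (A : I -> set T) (p : I -> R) : independent_systems G ->
  (forall i, G i `<=` measurable) -> (forall i, setC_closed (G i)) -> uniq s ->
  (forall i, i \in s -> G i (A i) /\ ((p i)%:E <= P (A i))%E) ->
  (P (\big[setI/setT]_(i <- s) ~` A i) <= (expR (- \sum_(i <- s) p i))%:E)%E.
Proof.
move=> indepG mG GC us sA; rewrite indepG//; last by move=> i /sA[GA _]; exact: GC.
rewrite -sumrN expR_sum -prodEFin.
elim: s us sA => [|i s IH] /=; first by rewrite !big_nil.
move=> /andP[_ us] sA; rewrite !big_cons.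
have [GA pA] := sA i (mem_head _ _); have mA : measurable (A i) by exact: mG GA.
apply: lee_pmul => //; first exact: prode_ge0.
  rewrite probability_setC// (le_trans (leeB (lexx 1%E) pA))//.
  by rewrite -EFinB lee_fin; exact: expR_ge1Dx.
by apply: IH => // j sj; apply: sA; rewrite in_cons sj orbT.
Qed.

Lemma borel_cantelli_independent (G : nat -> set_system T) (A : nat -> set T)
    (p : nat -> R) : independent_systems G ->
  (forall i, G i `<=` measurable) -> (forall i, setC_closed (G i)) ->
  (forall i, G i (A i)) -> (\forall i \near \oo, ((p i)%:E <= P (A i))%E) ->
  series p n @[n --> \oo] --> +oo ->
  {ae P, forall w, infinitely_often (fun i => A i w)}.
Proof.
move=> indepG mG GC GA [M _ pA] /cvgryPge divp; apply: ae_foralln => N.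
pose L := maxn N M.
apply: (@negligibleS _ _ _ _ (\bigcap_(i in [set i | (L <= i)%N]) ~` A i)).
  move=> w /= nio i Li; rewrite /setC/= => Aiw; apply: nio; exists i => //.
  exact: leq_trans (leq_maxl _ _) Li.
apply: negligible_outer_measure0; apply/eqP.
rewrite eq_le outer_measure_ge0 andbT; apply/lee_addgt0Pr => e e0; rewrite add0e.
near \oo => n; have Ln : (L <= n)%N by near: n; exact: nbhs_infty_ge.
have en : series p L - ln e <= series p n by near: n; exact: divp.
have avoid := independent_avoid_ub (s := index_iota L n) (A := A) (p := p) indepG mG GC.
apply: (@le_trans _ _ (expR (- \sum_(L <= i < n) p i))%:E); last first.
  rewrite lee_fin -[leRHS]lnK ?posrE// ler_expR -sub_series_geq//; lra.
apply: le_trans (avoid _ _); last 2 first.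
- exact: iota_uniq.
- move=> i; rewrite mem_index_iota => /andP[Li _]; split=> //; apply: pA.
  exact: leq_trans (leq_maxr _ _) Li.
rewrite -outer_probabilityE.
  apply: le_outer_measure; rewrite -bigcap_seq => w nA i /=.
  by rewrite mem_index_iota => /andP[Li _]; exact: nA.
by apply: measurable_bigsetI => i _; apply: mG; exact: GC.
Unshelve. all: by end_near. Qed.

End independence.

Section log_asymptotics.
Context {R : realType}.
Implicit Types (x y a c e p q s t : R) (n k : nat).

Lemma lnB_le x y : 0 < x -> 0 < y -> ln y - ln x <= (y - x) / x.
Proof.
move=> x0 y0; rewrite -ln_div ?posrE// mulrBl divff ?gt_eqF//.
have yx : 0 < y / x by rewrite divr_gt0.
by have := @le_ln1Dx R (y / x - 1); rewrite addrCA subrr addr0; apply; lra.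
Qed.

Lemma ln2_gt0 : 0 < ln 2 :> R.
Proof. by rewrite ln_gt0// ltr1n. Qed.

Lemma ln2_le1 : ln 2 <= 1 :> R.
Proof. by have := lnB_le ltr01 (ltr0n R 2); rewrite ln1 subr0 divr1; lra. Qed.

Lemma ln_exp2 k : ln (2 ^ k)%:R = k%:R * ln 2 :> R.
Proof. by rewrite natrX lnXn// mulr_natl. Qed.

Lemma near_powR_ge a e : 0 < e -> \forall x \near +oo, a <= x `^ e.
Proof.
move=> e0; near=> x; apply: le_trans (ler_norm a) _.
have ax : `|a| `^ e^-1 <= x by near: x; apply: nbhs_pinfty_ge; exact: num_real.
rewrite -[`|a|]powRr1// -(mulVf (lt0r_neq0 e0)) powRrM.
by rewrite ge0_ler_powR ?nnegrE ?powR_ge0 ?(ltW e0)// (le_trans (powR_ge0 _ _) ax).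
Unshelve. all: by end_near. Qed.

Lemma near_ln_le_powR c e : 0 < c -> 0 < e ->
  \forall x \near +oo, ln x <= c * x `^ e.
Proof.
move=> c0 e0; have e2 : 0 < e / 2 by rewrite divr_gt0.
near=> x; have x0 : 0 < x by near: x; apply: nbhs_pinfty_gt; exact: num_real.
have ux : (c * (e / 2))^-1 <= x `^ (e / 2) by near: x; exact: near_powR_ge.
set u := x `^ (e / 2) in ux; have u0 : 0 < u by exact: powR_gt0.
have -> : x `^ e = u * u by rewrite -powRD -?splitr// gt_eqF ?implybT.
have : e / 2 * ln x < u by rewrite -ln_powR; exact: ln_sublinear.
rewrite mulrC -ltr_pdivlMr// => /ltW/le_trans; apply.
rewrite ler_pdivrMr//.
have -> : c * (u * u) * (e / 2) = u * (u * (c * (e / 2))) by ring.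
by rewrite ler_peMr ?(ltW u0)// -ler_pdivrMr ?mul1r// mulr_gt0.
Unshelve. all: by end_near. Qed.

Lemma near_expRN_powR_le a e q : 0 < a -> 0 < e ->
  \forall x \near +oo, expR (- (a * x `^ e)) <= x `^ (- q).
Proof.
move=> a0 e0; near=> x.
have x1 : 1 < x by near: x; apply: nbhs_pinfty_gt; exact: num_real.
have lnx : 0 <= ln x by rewrite ln_ge0// ltW.
have q0 : 0 < `|q| + 1 by rewrite ltr_wpDl.
have : ln x <= a / (`|q| + 1) * x `^ e.
  by near: x; apply: near_ln_le_powR => //; rewrite divr_gt0.
rewrite mulrAC ler_pdivlMr// => lnxa.
rewrite /powR gt_eqF ?(lt_trans _ x1)// in lnxa *; rewrite ler_expR mulNr lerN2.
apply: le_trans lnxa; rewrite mulrC ler_wpM2l//.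
by apply: le_trans (ler_norm q) _; rewrite lerDl.
Unshelve. all: by end_near. Qed.

Lemma cvg_ln_nat : ln (n%:R : R) @[n --> \oo] --> +oo.
Proof.
apply/cvgryPge => a; near=> n.
have an : expR a <= n%:R by near: n; exact: nbhs_infty_ger.
by rewrite -(expRK a) ler_ln ?posrE ?expR_gt0 ?(lt_le_trans (expR_gt0 a)).
Unshelve. all: by end_near. Qed.

Lemma near_ln_ge a : \forall n \near \oo, a <= ln (n%:R : R).
Proof. by move: a; apply/cvgryPge; exact: cvg_ln_nat. Qed.

Lemma near_lnln_ge a : \forall n \near \oo, a <= ln (ln (n%:R : R)).
Proof.
near=> n; have an : expR a <= ln n%:R by near: n; exact: near_ln_ge.
by rewrite -(expRK a) ler_ln ?posrE ?expR_gt0 ?(lt_le_trans (expR_gt0 a)).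
Unshelve. all: by end_near. Qed.

Lemma near_lnln_gt0 : \forall n \near \oo, 0 < ln (ln (n%:R : R)).
Proof. by apply: filterS (near_lnln_ge 1) => n; exact: lt_le_trans. Qed.

Lemma near_ln_nat (Q : R -> Prop) :
  (\forall x \near +oo, Q x) -> \forall n \near \oo, Q (ln n%:R).
Proof. exact: cvg_ln_nat. Qed.

Lemma riemannR_telescope e n : 0 < e ->
  riemannR (1 + e) n.+1 <= e^-1 * (n.+1%:R `^ (- e) - n.+2%:R `^ (- e)).
Proof.
move=> e0; set m := n.+2%:R; have m0 : 0 < m :> R by [].
have lnm : m^-1 <= ln m - ln n.+1%:R.
  have := lnB_le m0 (ltr0Sn R n).
  rewrite {2}/m -[n.+2%:R]natr1 opprD addrA subrr add0r mulN1r => le_lnB.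
  by rewrite -lerN2 opprB.
have g0 : 0 < m `^ (- e) by exact: powR_gt0.
have -> : n.+1%:R `^ (- e) = m `^ (- e) * expR (e * (ln m - ln n.+1%:R)).
  by rewrite /powR !gt_eqF// -expRD; congr expR; ring.
have -> : riemannR (1 + e) n.+1 = m `^ (- e) * m^-1.
  by rewrite /riemannR -powRN opprD addrC powRD ?powR_inv1 ?(gt_eqF m0) ?implybT ?ltW.
rewrite ler_pdivlMl// mulrCA -[X in _ <= _ - X]mulr1 -mulrBr ler_pM2l//.
rewrite lerBrDl; apply: le_trans (expR_ge1Dx _).
by rewrite lerD2l ler_pM2l.
Qed.

Lemma series_riemannR_le p n : 1 < p -> series (riemannR p) n <= 1 + (p - 1)^-1.
Proof.
move=> p1; pose e := p - 1; have e0 : 0 < e by rewrite subr_gt0.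
have pE : p = 1 + e by rewrite addrC subrK.
have tele k : series (riemannR p) k.+1 <= 1 + e^-1 * (1 - k.+1%:R `^ (- e)).
  elim: k => [|k IH].
    rewrite seriesSr/= /series/= big_geq// add0r /riemannR !powR1 invr1.
    by rewrite subrr mulr0 addr0.
  rewrite seriesSr; apply: le_trans (lerD IH (_ : _ <= e^-1 * _)) _.
    by rewrite pE; exact: riemannR_telescope.
  by rewrite -addrA -mulrDr addrA subrK.
case: n => [|n]; first by rewrite /series/= big_geq// addr_ge0 ?invr_ge0 ?ltW.
apply: le_trans (tele n) _.
by rewrite lerD2l ler_piMr ?invr_ge0 ?(ltW e0)// gerBl powR_ge0.
Qed.

Lemma dvg_series_inv_mul_ln :
  series (fun i => (i.+1%:R * ln (i.+1%:R : R))^-1) n @[n --> \oo] --> +oo.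
Proof.
set u := (X in series X); suff lnln n : ln (ln n.+1%:R) <= series u n.
  apply/cvgryPge => a; have [N _ aN] := near_lnln_ge a; exists N => // n Nn /=.
  by apply: (le_trans _ (lnln n)); apply: aN; exact: leqW.
(* the summand at [i = 0] is [0^-1 = 0], and [ln 0 = 0] *)
elim: n => [|[_|n IH]]; first by rewrite ln1 ln0// /series/= big_geq.
  by rewrite seriesSr /series/= big_geq// /u ln1 mulr0 invr0 addr0 ln_le0// ln2_le1.
rewrite seriesSr; apply: le_trans (lerD IH (lexx _)); rewrite -lerBlDl /u.
have l0 : 0 < ln (n.+2%:R : R) by rewrite ln_gt0// ltr1n.
have l1 : 0 < ln (n.+3%:R : R) by rewrite ln_gt0// ltr1n.
apply: le_trans (lnB_le l0 l1) _; rewrite invfM ler_wpM2r ?invr_ge0 ?(ltW l0)//.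
apply: le_trans (lnB_le _ _) _ => //; rewrite -[n.+3%:R]natr1 addrAC subrr add0r.
by rewrite mul1r.
Qed.

End log_asymptotics.

Section level.
Context {R : realType}.
Implicit Types (s t e : R) (n m : nat) (u : nat -> R).

Definition level s n : R := ln n%:R + s * ln (ln n%:R).

Lemma levelB s t n : level s n - level t n = (s - t) * ln (ln n%:R).
Proof. by rewrite /level; ring. Qed.

Lemma natr_expR_level s n : (1 < n)%N -> n%:R * expR (- level s n) = ln n%:R `^ (- s).
Proof.
move=> n1; have n0 : 0 < n%:R :> R by rewrite ltr0n ltnW.
rewrite /powR gt_eqF ?ln_gt0 ?ltr1n// /level opprD expRD expRN lnK// mulrA.
by rewrite divff ?gt_eqF// mul1r mulNr.
Qed.

Lemma near_level_le s t : s <= t -> \forall n \near \oo, level s n <= level t n.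
Proof.
move=> st; near=> n; rewrite lerD2l ler_wpM2r//.
by near: n; exact: near_lnln_ge.
Unshelve. all: by end_near. Qed.

Lemma near_level_bounds s :
  \forall n \near \oo, ln n%:R / 2 <= level s n <= 2 * ln n%:R - 2.
Proof.
have s4 : 0 < 4 * (`|s| + 1) by rewrite mulr_gt0// ltr_wpDl.
have c0 : 0 < (4 * (`|s| + 1))^-1 by rewrite invr_gt0.
have lnx := near_ln_nat (near_ln_le_powR c0 ltr01).
near=> n; have l8 : 8 <= ln (n%:R : R) by near: n; exact: near_ln_ge.
have ll0 : 0 <= ln (ln (n%:R : R)) by near: n; exact: near_lnln_ge.
have : ln (ln (n%:R : R)) <= (4 * (`|s| + 1))^-1 * ln n%:R `^ 1 by near: n.
rewrite powRr1; last lra.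
rewrite ler_pdivlMl// => lnl.
have := ler_wpM2r ll0 (ler_norm s); have := ler_wpM2r ll0 (ler_norm (- s)).
by rewrite normrN /level => sl Nsl; apply/andP; split; lra.
Unshelve. all: by end_near. Qed.

Lemma level_le_double s e : 0 < e -> \forall n \near \oo,
  forall m, (n <= m <= 2 * n)%N -> level s m <= level (s + e) n.
Proof.
move=> e0; near=> n => m /andP[nm m2n].
have l1 : 1 <= ln (n%:R : R) by near: n; exact: near_ln_ge.
have : (1 + `|s|) / e <= ln (ln (n%:R : R)) by near: n; exact: near_lnln_ge.
have n0 : 0 < n%:R :> R by rewrite ltr0n; near: n; exact: nbhs_infty_gt.
have m0 : 0 < m%:R :> R by rewrite (lt_le_trans n0)// ler_nat.
have ln_nm : ln n%:R <= ln (m%:R : R) by rewrite ler_ln ?posrE// ler_nat.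
have lnm : ln m%:R <= ln n%:R + 1 :> R.
  rewrite -lerBlDl; apply: le_trans (lnB_le n0 m0) _.
  by rewrite ler_pdivrMr// mul1r lerBlDr -natrD ler_nat addnn -mul2n.
have l0 : 0 < ln (n%:R : R) by rewrite (lt_le_trans _ l1).
have lm0 : 0 < ln (m%:R : R) by rewrite (lt_le_trans l0).
have lnln_nm : ln (ln n%:R) <= ln (ln (m%:R : R)) by rewrite ler_ln ?posrE.
have lnlnm : ln (ln m%:R) <= ln (ln n%:R) + 1 :> R.
  rewrite -lerBlDl; apply: le_trans (lnB_le l0 lm0) _.
  by rewrite ler_pdivrMr// mul1r lerBlDr (le_trans lnm)// addrC lerD2r.
have : s * (ln (ln m%:R) - ln (ln n%:R)) <= `|s|.
  apply: le_trans (ler_norm _) _; rewrite normrM [X in _ * X]ger0_norm ?subr_ge0//.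
  by rewrite ler_piMr// lerBlDl.
rewrite ler_pdivrMr// /level; lra.
Unshelve. all: by end_near. Qed.

Lemma near_trunc_log n : \forall m \near \oo, (n <= trunc_log 2 m)%N.
Proof.
near=> m; rewrite -(@trunc_expnK 2 n)//; apply: leq_trunc_log.
by near: m; exact: nbhs_infty_ge.
Unshelve. all: by end_near. Qed.

Lemma near_le_level_dyadic u s e : nondecreasing_seq u -> 0 < e ->
  (\forall k \near \oo, u (2 ^ k)%N <= level s (2 ^ k)%N) ->
  \forall n \near \oo, u n <= level (s + e) n.
Proof.
move=> ndu e0 [K _ uK]; near=> n; have n0 : (0 < n)%N by near: n; exact: nbhs_infty_gt.
have : (K <= trunc_log 2 n)%N by near: n; exact: near_trunc_log.
set k := trunc_log 2 n => Kk.
have /andP[kn nk] := trunc_log_bounds (isT : 1 < 2)%N n0.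
apply: le_trans (ndu _ _ (ltnW nk)) _; apply: le_trans (uK k.+1 (leqW Kk)) _.
have : (n <= 2 ^ k.+1 <= 2 * n)%N by rewrite (ltnW nk) expnS leq_mul2l kn orbT.
by move: (2 ^ k.+1)%N; near: n; exact: level_le_double.
Unshelve. all: by end_near. Qed.

Lemma near_ge_level_dyadic u s e : nondecreasing_seq u -> 0 < e ->
  (\forall k \near \oo, level s (2 ^ k)%N <= u (2 ^ k)%N) ->
  \forall n \near \oo, level (s - e) n <= u n.
Proof.
move=> ndu e0 [K _ uK]; have [M _ leM] := level_le_double (s - e) e0.
rewrite subrK in leM.
near=> n; have n0 : (0 < n)%N by near: n; exact: nbhs_infty_gt.
have : (maxn K M <= trunc_log 2 n)%N by near: n; exact: near_trunc_log.
set k := trunc_log 2 n; rewrite geq_max => /andP[Kk Mk].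
have /andP[kn nk] := trunc_log_bounds (isT : 1 < 2)%N n0.
apply: (le_trans _ (ndu _ _ kn)); apply: (le_trans _ (uK k Kk)).
apply: leM; first exact: leq_trans Mk (ltnW (ltn_expl _ _)).
by rewrite kn -expnS ltnW.
Unshelve. all: by end_near. Qed.

End level.

Section log_decay.
Context {R : realType} {dT : measure_display} {T : measurableType dT}.
Variable P : probability T R.
Implicit Types (A : nat -> set T) (p : R).

Definition log_decay A p :=
  exists C : R, \forall n \near \oo, (P^* (A n) <= (C * ln n%:R `^ (- p))%:E)%E.

Lemma log_decay_vanishing A p : 0 < p -> log_decay A p -> vanishing P A.
Proof.
move=> p0 [C AC]; apply: (@squeeze_cvge _ _ _ _ (fun=> 0%E) _
    (fun n => (`|C| * ln n%:R `^ (- p))%:E)).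
- apply: filterS AC => n /le_trans An; rewrite outer_measure_ge0/= An//.
  by rewrite lee_fin ler_wpM2r ?powR_ge0// ler_norm.
- exact: cvg_cst.
- apply: cvg_EFin; first exact: nearW.
  apply/cvgrPdist_le => e e0; have Ce := near_ln_nat (near_powR_ge (`|C| / e) p0).
  near=> n; have l0 : 0 < ln (n%:R : R).
    by apply: (lt_le_trans ltr01); near: n; exact: near_ln_ge.
  rewrite sub0r normrN ger0_norm ?mulr_ge0 ?powR_ge0//.
  rewrite /= powRN ler_pdivrMr ?powR_gt0// mulrC -ler_pdivrMr//.
  by near: n.
Unshelve. all: by end_near. Qed.

Lemma log_decay_ae_dyadic A p : 1 < p -> log_decay A p ->
  {ae P, forall w, \forall k \near \oo, ~ A (2 ^ k)%N w}.
Proof.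
move=> p1 [C [N _ AC]]; pose D := `|C| * ln 2 `^ (- p).
have D0 : 0 <= D by rewrite mulr_ge0// powR_ge0.
have AD k : (P^* (A (2 ^ (N + k.+1))%N) <= (D * riemannR p k)%:E)%E.
  apply: le_trans (AC _ _) _.
    rewrite /= (leq_trans (ltnW (ltn_expl _ (isT : 1 < 2)%N)))//.
    by rewrite leq_exp2l// leq_addr.
  rewrite ln_exp2 powRM ?(ltW ln2_gt0)// lee_fin /D -mulrA.
  apply: (le_trans (ler_wpM2r _ (ler_norm C))); first by rewrite mulr_ge0 ?powR_ge0.
  rewrite ler_wpM2l// mulrC ler_wpM2l ?powR_ge0// powRN.
  rewrite lef_pV2 ?posrE ?powR_gt0// ?ltr0n ?addnS//.
  by rewrite ge0_ler_powR ?nnegrE ?ler_nat ?ltnS ?leq_addl// ltW// (lt_trans ltr01).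
have : {ae P, forall w, \forall k \near \oo, ~ A (2 ^ (N + k.+1))%N w}.
  apply: borel_cantelli.
  apply: (@le_lt_trans _ _ (D * (1 + (p - 1)^-1))%:E); last exact: ltry.
  apply: lime_le; first by apply: is_cvg_nneseries => k _ _; exact: outer_measure_ge0.
  apply: nearW => n; apply: (@le_trans _ _ (\sum_(0 <= k < n) (D * riemannR p k)%:E)%E).
    by apply: lee_sum => k _; exact: AD.
  by rewrite sumEFin -mulr_sumr lee_fin ler_wpM2l// series_riemannR_le.
apply: filterS => w [K _ AK]; exists (N + K.+1)%N => // k /= NKk.
have := AK (k - N).-1; rewrite /= prednK ?subnKC; try lia.
by apply; lia.
Qed.

End log_decay.

Section almost_sure_level.
Context {R : realType} {dT : measure_display} {T : measurableType dT}.
Variable P : probability T R.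
Implicit Types (F : T -> nat -> R) (s e : R).

Lemma ae_forall_gt0 (Q : R -> T -> Prop) :
  (forall e e' w, e <= e' -> Q e w -> Q e' w) ->
  (forall e, 0 < e -> {ae P, forall w, Q e w}) ->
  {ae P, forall w, forall e, 0 < e -> Q e w}.
Proof.
move=> Qle aeQ; have inv_gt0 k : 0 < k.+1%:R^-1 :> R by rewrite invr_gt0.
apply: filterS (ae_foralln (fun k => aeQ _ (inv_gt0 k))) => w Qw e e0.
apply: (Qle (Num.truncn e^-1).+1%:R^-1) => //.
by rewrite invf_ple ?posrE//; exact/ltW/truncnS_gt.
Qed.

Lemma ae_near_le_level F s : (forall w, nondecreasing_seq (F w)) ->
  (forall e, 0 < e -> exists2 p, 1 < p &
     log_decay P (fun n => [set w | level (s + e) n < F w n]) p) ->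
  {ae P, forall w, forall e, 0 < e -> \forall n \near \oo, F w n <= level (s + e) n}.
Proof.
move=> ndF decayF; apply: ae_forall_gt0 => [e e' w ee'|e e0].
  apply: filterS2 (near_level_le _) => [n /[swap]|]; first exact: le_trans.
  by rewrite lerD2l.
have e2 : 0 < e / 2 by rewrite divr_gt0.
have [p p1 /(log_decay_ae_dyadic p1)] := decayF _ e2; apply: filterS => w Fw.
rewrite [e]splitr addrA; apply: near_le_level_dyadic => //.
by apply: filterS Fw => k /negP; rewrite -leNgt.
Qed.

Lemma ae_near_ge_level F s : (forall w, nondecreasing_seq (F w)) ->
  (forall e, 0 < e -> exists2 p, 1 < p &
     log_decay P (fun n => [set w | F w n < level (s - e) n]) p) ->
  {ae P, forall w, forall e, 0 < e -> \forall n \near \oo, level (s - e) n <= F w n}.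
Proof.
move=> ndF decayF; apply: ae_forall_gt0 => [e e' w ee'|e e0].
  apply: filterS2 (near_level_le _) => [n|]; first exact: le_trans.
  by rewrite lerD2l lerN2.
have e2 : 0 < e / 2 by rewrite divr_gt0.
have [p p1 /(log_decay_ae_dyadic p1)] := decayF _ e2; apply: filterS => w Fw.
rewrite [e]splitr opprD addrA; apply: near_ge_level_dyadic => //.
by apply: filterS Fw => k /negP; rewrite -leNgt.
Qed.

End almost_sure_level.

Section limsup_liminf.
Context {R : realType}.
Implicit Types (u : nat -> R) (l : R).

Lemma limn_esup_EFin u l :
  (forall e, 0 < e -> \forall n \near \oo, u n <= l + e) ->
  (forall e, 0 < e -> infinitely_often (fun n => l - e <= u n)) ->
  limn_esup (fun n => (u n)%:E) = l%:E.
Proof.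
move=> ul lu; apply/eqP; rewrite eq_le; apply/andP; split.
  apply/lee_addgt0Pr => e e0; rewrite -EFinD; have [N _ uN] := ul e e0.
  apply: (@le_trans _ _ (ereal_sup [set (u n)%:E | n in [set n | (N <= n)%N]])).
    by apply: ereal_inf_lbound; exists [set n | (N <= n)%N] => //; exists N.
  by apply: ge_ereal_sup => _ [n Nn <-]; rewrite lee_fin; exact: uN.
apply: le_ereal_inf_tmp => _ [V [N _ NV] <-].
apply/lee_addgt0Pr => e e0; rewrite -leeBlDr// -EFinB.
have [n Nn un] := lu e e0 N; apply: (@le_trans _ _ (u n)%:E); first by rewrite lee_fin.
by apply: ereal_sup_ubound; exists n => //; exact: NV.
Qed.

Lemma limn_einf_EFin u l :
  (forall e, 0 < e -> \forall n \near \oo, l - e <= u n) ->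
  (forall e, 0 < e -> infinitely_often (fun n => u n <= l + e)) ->
  limn_einf (fun n => (u n)%:E) = l%:E.
Proof.
move=> lu ul; rewrite /limn_einf.
have -> : (\- (fun n => (u n)%:E))%E = (fun n => (- u n)%:E) by [].
rewrite (@limn_esup_EFin (fun n => - u n) (- l)) ?EFinN ?oppeK// => e e0.
  by apply: filterS (lu e e0) => n; lra.
move=> N; have [n Nn un] := ul e e0 N; exists n => //; lra.
Qed.

End limsup_liminf.

Lemma exponential_prob_itvoy (R : realType) (rate a : R) : 0 < rate -> 0 <= a ->
  exponential_prob rate `]a, +oo[ = (expR (- rate * a))%:E.
Proof.
move=> rate0 a0; have mpdf := measurable_exponential_pdf rate.
rewrite /exponential_prob integral_itv_obnd_cbnd; last first.
  by apply/measurable_funTS/measurable_EFinP.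
have cexp : continuous (fun x : R => - expR (- rate * x)).
  move=> x; apply: cvgN; apply: continuous_comp; last exact: continuous_expR.
  exact: mulrl_continuous.
rewrite (@ge0_continuous_FTC2y _ _ (fun x => - expR (- rate * x)) _ 0).
- by rewrite -EFinB sub0r opprK.
- by move=> x _; exact: exponential_pdf_ge0 (ltW rate0) _.
- apply: (@continuous_subspaceW R^o _ _ `[0, +oo[).
    by apply: subset_itvr; rewrite bnd_simp.
  exact: within_continuous_exponential_pdf.
- rewrite -oppr0; apply: cvgN; under eq_cvg do rewrite mulNr.
  apply: (@cvg_comp _ _ _ ( *%R rate) (fun z : R => expR (- z)) _ (pinfty_nbhs R)).
    exact: gt0_cvgMry.
  exact: cvgr_expR.
- by move=> x _; exact: ex_derive.
- exact/cvg_at_right_filter/cexp.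
- move=> x; rewrite in_itv/= andbT => ax; apply: derive1_exponential_pdf.
  by rewrite in_itv/= andbT (le_lt_trans a0).
Qed.

Section exponential_sample.
Context {R : realType} {d : nat} {dT : measure_display} {T : measurableType dT}
  {P : probability T R}.
Variable X : nat -> 'I_d -> {RV P >-> R}.
Hypothesis indepX : mutually_independent (fun ij : nat * 'I_d => X ij.1 ij.2).
Hypothesis expX : forall (i : nat) (j : 'I_d) (A : set R), measurable A ->
  distribution P (X i j) A = exponential_prob (1 : R) A.
Implicit Types (i : nat) (j : 'I_d) (B : 'I_d -> set R) (y : 'rV[R]_d) (t : R).

Lemma measurable_preimage_coord i j (A : set R) :
  measurable A -> measurable (X i j @^-1` A).
Proof. by move=> mA; rewrite -[X in measurable X]setTI; exact: measurable_funP. Qed.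

Lemma prob_coord_gt i j (a : R) : 0 <= a ->
  P (X i j @^-1` `]a, +oo[) = (expR (- a))%:E.
Proof.
move=> a0; rewrite -[LHS]/(distribution P (X i j) _) expX//.
by rewrite exponential_prob_itvoy// mulN1r.
Qed.

Lemma prob_coord_unit_itv i j (a : R) : 0 <= a ->
  P (X i j @^-1` `]a, a + 1]) = (expR (- a) * (1 - expR (-1)))%:E.
Proof.
move=> a0; pose gt_ (b : R) : set T := X i j @^-1` `]b, +oo[.
have mgt b : measurable (gt_ b) by exact: measurable_preimage_coord.
have sub : gt_ (a + 1) `<=` gt_ a.
  by move=> w; rewrite /gt_/= !in_itv/= !andbT; apply: lt_trans; lra.
have -> : X i j @^-1` `]a, a + 1] = gt_ a `\` gt_ (a + 1).
  apply/seteqP; split=> w; rewrite /gt_/= !in_itv/= !andbT.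
    by move=> /andP[-> aw]; split=> //; apply/negP; rewrite -leNgt.
  by move=> [-> /negP]; rewrite -leNgt.
transitivity (P (gt_ a) - P (gt_ (a + 1)%R))%E.
  rewrite -[in RHS](setIidr sub); apply: measureD => //.
  by rewrite (le_lt_trans (probability_le1 P _)) ?ltry.
by rewrite !prob_coord_gt//; [rewrite -EFinB opprD expRD mulrBr mulr1|lra].
Qed.

Definition box i B : set T := [set w | forall j, B j (X i j w)].

Definition obs_boxes i : set_system T :=
  [set box i B | B in [set B | forall j, measurable (B j)]].

Lemma measurable_box i B : (forall j, measurable (B j)) -> measurable (box i B).
Proof.
move=> mB; have -> : box i B = \bigcap_j X i j @^-1` B j.
  by apply/seteqP; split=> w Bw j; [move=> _|]; exact: Bw.
by apply: fin_bigcap_measurable => // j _; exact: measurable_preimage_coord.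
Qed.

Lemma measurable_obs_boxes i : obs_boxes i `<=` measurable.
Proof. by move=> _ [B mB <-]; exact: measurable_box. Qed.

Lemma obs_boxesT i : obs_boxes i setT.
Proof. by exists (fun=> setT) => //; apply/seteqP. Qed.

Lemma obs_boxesI i : setI_closed (obs_boxes i).
Proof.
move=> _ _ [B mB <-] [C mC <-]; exists (fun j => B j `&` C j).
  by move=> j; exact: measurableI.
by apply/seteqP; split=> w /= => [BC|[Bw Cw] j]; [split=> j; have [] := BC j|].
Qed.

Lemma prob_boxes (s : seq nat) (B : nat -> 'I_d -> set R) :
  uniq s -> (forall i j, i \in s -> measurable (B i j)) ->
  P (\big[setI/setT]_(i <- s) box i (B i)) =
  (\prod_(i <- s) \prod_j P (X i j @^-1` B i j))%E.
Proof.
move=> us mB; pose r := [seq (i, j) | i <- s, j <- enum 'I_d].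
have ur : uniq r by apply: allpairs_uniq => //; [exact: enum_uniq|move=> [? ?] [? ?]].
have mr ij : ij \in r -> measurable (B ij.1 ij.2).
  by move=> /allpairsP[[i j] [/= si _ ->]]; exact: mB.
have -> : \big[setI/setT]_(i <- s) box i (B i) =
    [set w | forall ij, ij \in r -> B ij.1 ij.2 (X ij.1 ij.2 w)].
  rewrite -bigcap_seq; apply/seteqP; split=> w /= Bw.
    by move=> _ /allpairsP[[i j] [/= si _ ->]]; exact: Bw.
  move=> i si j; apply: (Bw (i, j)); apply/allpairsP.
  by exists (i, j); rewrite /= mem_enum.
rewrite (indepX (B := fun ij => B ij.1 ij.2) ur mr) big_allpairs_dep.
by apply: eq_bigr => i _; rewrite big_enum.
Qed.

Lemma prob_box i B : (forall j, measurable (B j)) ->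
  P (box i B) = (\prod_j P (X i j @^-1` B j))%E.
Proof.
move=> mB; have := @prob_boxes [:: i] (fun=> B) isT (fun _ j _ => mB j).
by rewrite !big_seq1.
Qed.

Lemma independent_obs_boxes : independent_systems P obs_boxes.
Proof.
move=> s A us sA.
have repr i : exists B, i \in s -> (forall j, measurable (B j)) /\ box i B = A i.
  have [si|_] := boolP (i \in s); last by exists (fun=> setT).
  by have [B mB BA] := sA i si; exists B.
have [B sB] := choice repr.
rewrite (eq_big_seq (fun i => box i (B i))); last by move=> i /sB[].
rewrite prob_boxes//; last by move=> i j /sB[].
by apply: eq_big_seq => i /sB[mB <-]; rewrite prob_box.
Qed.

Definition obs_sigma i : set_system T := <<s obs_boxes i >>.

Lemma independent_obs_sigma : independent_systems P obs_sigma.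
Proof.
apply: independent_generated.
- exact: independent_obs_boxes.
- exact: measurable_obs_boxes.
- exact: obs_boxesI.
- exact: obs_boxesT.
Qed.

Lemma measurable_obs_sigma i : obs_sigma i `<=` measurable.
Proof.
apply: smallest_sub; first exact: sigma_algebra_measurable.
exact: measurable_obs_boxes.
Qed.

Lemma obs_sigmaC i : setC_closed (obs_sigma i).
Proof.
move=> A; rewrite -setTD.
by have [_ + _] := smallest_sigma_algebra setT (obs_boxes i); exact.
Qed.

Definition above y i : set T := [set w | strictly_below y (sample X w i)].

Lemma above_box y i : above y i = box i (fun j => `]y ord0 j, +oo[%classic).
Proof.
by apply/seteqP; split=> w yw j; have := yw j; rewrite /= mxE in_itv/= andbT.
Qed.

Lemma obs_sigma_above y i : obs_sigma i (above y i).
Proof.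
apply: sub_gen_smallest; rewrite above_box.
by exists (fun j => `]y ord0 j, +oo[%classic).
Qed.

Lemma measurable_above y i : measurable (above y i).
Proof. by apply: (@measurable_obs_sigma i); exact: obs_sigma_above. Qed.

Lemma prob_above y i : orthant y -> P (above y i) = (expR (- coord_sum y))%:E.
Proof.
move=> y0; rewrite above_box prob_box// -sumrN expR_sum -prodEFin.
by apply: eq_bigr => j _; exact: prob_coord_gt.
Qed.

Definition large_sum t i : set T :=
  [set w | strictly_below 0 (sample X w i) /\ t < coord_sum (sample X w i)].

Lemma coord_sum_sample w i : coord_sum (sample X w i) = \sum_j X i j w.
Proof. by apply: eq_bigr => j _; rewrite mxE. Qed.

Lemma obs_sigma_large_sum t i : obs_sigma i (large_sum t i).
Proof.
pose S := g_sigma_algebraType (obs_boxes i).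
have mX j : measurable_fun [set: S] (X i j : S -> R).
  move=> _ A mA; rewrite setTI; apply: sub_gen_smallest.
  exists (fun k => if k == j then A else setT); first by move=> k; case: ifP.
  apply/seteqP; split=> w /=; first by move/(_ j); rewrite eqxx.
  by move=> Aw k; case: eqP => // ->.
have msum : measurable_fun [set: S] (fun w => \sum_j (X i j : S -> R) w).
  exact: measurable_sum.
suff : (@measurable _ S) (large_sum t i) by [].
rewrite (_ : large_sum t i = above 0 i `&` (fun w => \sum_j X i j w) @^-1` `]t, +oo[).
  apply: measurableI; first exact: obs_sigma_above.
  by rewrite -[X in measurable X]setTI; exact: msum.
by apply/seteqP; split=> w; rewrite /large_sum /= coord_sum_sample in_itv/= andbT.
Qed.

Lemma measurable_large_sum t i : measurable (large_sum t i).
Proof. by apply: (@measurable_obs_sigma i); exact: obs_sigma_large_sum. Qed.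

End exponential_sample.
Arguments measurable_obs_sigma {R d dT T P} X i.
Arguments obs_sigmaC {R d dT T P} X i.
Arguments obs_sigma_above {R d dT T P} X y i.
Arguments obs_sigma_large_sum {R d dT T P} X t i.

Section record_frontier.
Context {R : realType} {d' : nat} {dT : measure_display} {T : measurableType dT}
  {P : probability T R}.
Local Notation d := d'.+1.
Variable X : nat -> 'I_d -> {RV P >-> R}.
Hypothesis indepX : mutually_independent (fun ij : nat * 'I_d => X ij.1 ij.2).
Hypothesis expX : forall (i : nat) (j : 'I_d) (A : set R), measurable A ->
  distribution P (X i j) A = exponential_prob (1 : R) A.
Implicit Types (s t c e M : R) (n m i q : nat) (w : T) (x : 'rV[R]_d).

Lemma prob_large_sum_ub t i : 0 <= t ->
  (P^* (large_sum X t i) <= ((t + 2) ^+ d' * expR (d'%:R - t))%:E)%E.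
Proof.
move=> t0; pose b := (Num.truncn t).+1.
pose A (z : {ffun 'I_d' -> 'I_b.+1}) := above X (staircase (t - d'%:R) z) i.
have sub : large_sum X t i `<=` \bigcup_z A z.
  move=> w [X0 tX]; have [||z zX] := @exists_staircase_below _ _ b (t - d'%:R) _ X0.
  - by rewrite subrK.
  - by rewrite lerBlDr ler_wpDr// ltW// truncnS_gt.
  - by exists z.
apply: le_trans (le_outer_measure _ _ _ sub) _.
have PA z : (P^* (A z) <= (expR (d'%:R - t))%:E)%E.
  rewrite outer_probabilityE; last exact: measurable_above.
  rewrite (prob_above indepX expX)//; last exact: orthant_staircase.
  by rewrite lee_fin ler_expR lerNl opprB coord_sum_staircase_ge.
apply: le_trans (outer_measure_bigcup_fin PA) _.
rewrite card_ffun !card_ord lee_fin natrX ler_pM2r ?expR_gt0// lerXn2r ?nnegrE//.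
  by rewrite addr_ge0.
by rewrite /b -addn2 natrD lerD2r truncn_le.
Qed.

(* Disjoint boxes of equal probability inside [{t < x_+}]: unit intervals in all
   coordinates but the first, which takes up the rest of [t]. *)
Definition cell t q (v : {ffun 'I_d' -> 'I_q}) (j : 'I_d) : set R :=
  if unlift ord0 j is Some k then `](v k)%:R, (v k)%:R + 1]%classic
  else `]t - \sum_k (v k)%:R, +oo[%classic.

Lemma measurable_cell t q (v : {ffun 'I_d' -> 'I_q}) j : measurable (cell t v j).
Proof. by rewrite /cell; case: unlift. Qed.

Lemma cell_rest_ge0 t q (v : {ffun 'I_d' -> 'I_q}) : (q * d')%:R <= t ->
  0 <= t - \sum_k (v k)%:R.
Proof.
move=> qt; rewrite subr_ge0; apply: le_trans qt; rewrite -natr_sum ler_nat.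
apply: (@leq_trans (\sum_(k < d') q)%N); last by rewrite sum_nat_const card_ord mulnC.
by apply: leq_sum => k _; exact: ltnW.
Qed.

Lemma box_cell_sub t i q (v : {ffun 'I_d' -> 'I_q}) : (q * d')%:R <= t ->
  box X i (cell t v) `<=` large_sum X t i.
Proof.
move=> qt w vw.
have X0 : t - \sum_k (v k)%:R < X i ord0 w.
  by have := vw ord0; rewrite /cell unlift_none/= in_itv/= andbT.
have Xk k : (v k)%:R < X i (lift ord0 k) w.
  by have := vw (lift ord0 k); rewrite /cell liftK/= in_itv/= => /andP[].
split; last first.
  rewrite coord_sum_sample big_ord_recl -ltrBlDr; apply: le_lt_trans X0.
  by rewrite lerD2l lerN2; apply: ler_sum => k _; exact/ltW/Xk.
move=> j; rewrite !mxE; case: (unliftP ord0 j) => [k|] ->.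
  exact: le_lt_trans (Xk k).
by apply: le_lt_trans X0; exact: cell_rest_ge0.
Qed.

Lemma trivIset_box_cell t i q :
  trivIset setT (fun v : {ffun 'I_d' -> 'I_q} => box X i (cell t v)).
Proof.
move=> v v' _ _ [w [vw v'w]]; apply/ffunP => k; apply: val_inj => /=.
have := vw (lift ord0 k); have := v'w (lift ord0 k).
rewrite /cell !liftK/= !in_itv/= !natr1 => /andP[lo' up'] /andP[lo up].
have := lt_le_trans lo up'; have := lt_le_trans lo' up.
rewrite !ltr_nat !ltnS => v'v vv'.
by apply/eqP; rewrite eqn_leq vv' v'v.
Qed.

Lemma prob_box_cell t i q (v : {ffun 'I_d' -> 'I_q}) : (q * d')%:R <= t ->
  P (box X i (cell t v)) = ((1 - expR (-1)) ^+ d' * expR (- t))%:E.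
Proof.
move=> qt; rewrite (prob_box indepX); last exact: measurable_cell.
rewrite big_ord_recl {1}/cell unlift_none.
rewrite (prob_coord_gt expX) ?cell_rest_ge0//.
under [X in (_ * X)%E]eq_bigr do rewrite /cell liftK (prob_coord_unit_itv expX)//.
rewrite prodEFin -EFinM big_split/= prodr_const card_ord -expR_sum sumrN mulrA -expRD.
by rewrite opprB addrAC subrr add0r mulrC.
Qed.

Lemma prob_large_sum_cells_lb t i q : (q * d')%:R <= t ->
  (((q%:R * (1 - expR (-1))) ^+ d' * expR (- t))%:E <= P (large_sum X t i))%E.
Proof.
move=> qt; pose V := {ffun 'I_d' -> 'I_q}.
have mbox (v : V) : measurable (box X i (cell t v)).
  by apply: measurable_box; exact: measurable_cell.
have -> : ((q%:R * (1 - expR (-1))) ^+ d' * expR (- t))%:E =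
    P (\bigcup_(v : V) box X i (cell t v)).
  transitivity (\sum_(v : V) P (box X i (cell t v)))%E; last first.
    by apply/esym/measure_bigcup_fin => //; exact: trivIset_box_cell.
  under eq_bigr do rewrite prob_box_cell//.
  rewrite sumEFin sumr_const card_ffun !card_ord -[in RHS]mulr_natl natrX.
  by rewrite exprMn mulrA.
apply: le_measure; rewrite ?inE.
- by apply: fin_bigcup_measurable => //; exact: finite_finset.
- exact: measurable_large_sum.
- by apply: bigcup_sub => v _; exact: box_cell_sub.
Qed.

Lemma prob_large_sum_lb t i : d%:R <= t ->
  (((t / (4 * d)%:R) ^+ d' * expR (- t))%:E <= P (large_sum X t i))%E.
Proof.
move=> dt; pose q := Num.truncn (t / d%:R).
have t0 : 0 <= t by exact: le_trans dt.
have td1 : 1 <= t / d%:R by rewrite ler_pdivlMr ?mul1r.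
have half : 2^-1 <= 1 - expR (-1) :> R.
  have := expR_ge1Dx (1 : R); rewrite expRN => e2.
  have : (expR 1)^-1 <= 2^-1 :> R by rewrite lef_pV2 ?posrE ?expR_gt0.
  lra.
have q1 : 1 <= q%:R :> R by rewrite ler1n truncn_gt0.
have qS : t / d%:R < q%:R + 1 by rewrite natr1 truncnS_gt.
apply: le_trans (prob_large_sum_cells_lb _ (q := q) _); last first.
  apply: (@le_trans _ _ (q * d)%:R); first by rewrite ler_nat leq_mul2l leqnSn orbT.
  by rewrite natrM -ler_pdivlMr// truncn_le divr_ge0.
have tq : t / (4 * d)%:R <= q%:R * (1 - expR (-1)).
  rewrite natrM invfM mulrCA; have := ler_wpM2l (ler0n R q) half.
  by move: (t / d%:R) q%:R qS q1 => s u su u1; lra.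
rewrite lee_fin ler_pM2r ?expR_gt0//.
by rewrite lerXn2r ?nnegrE ?divr_ge0// (le_trans _ tq) ?divr_ge0.
Qed.

Lemma prob_avoid_ub n (A : nat -> set T) (p : R) :
  (forall i, obs_sigma X i (A i)) -> (forall i, (p%:E <= P (A i))%E) ->
  (P^* [set w | forall i, (i < n)%N -> ~ A i w] <= (expR (- (n%:R * p)))%:E)%E.
Proof.
move=> sA pA; have := independent_avoid_ub (s := index_iota 0 n) (A := A) (p := fun=> p)
  (independent_obs_sigma indepX) (measurable_obs_sigma X)
  (obs_sigmaC X) (iota_uniq _ _) (fun i _ => conj (sA i) (pA i)).
rewrite sumr_const_nat subn0 -[p *+ n]mulr_natl => avoid; apply: (le_trans _ avoid).
rewrite -outer_probabilityE; last first.
  apply: measurable_bigsetI => i _; apply: measurableC.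
  exact: measurable_obs_sigma (sA i).
apply: le_outer_measure; rewrite -bigcap_seq => w nA i /=.
by rewrite mem_index_iota; exact: nA.
Qed.

Lemma prob_Fplus_gt_ub n t : 0 <= t ->
  (P^* [set w | (t < Fplus (sample X w) n)%R] <=
   (n%:R * ((t + 2) ^+ d' * expR (d'%:R - t)))%:E)%E.
Proof.
move=> t0; rewrite -[in n%:R](card_ord n).
apply: (le_trans _ (outer_measure_bigcup_fin (fun i : 'I_n => prob_large_sum_ub i t0))).
apply: le_outer_measure => w /= /Fplus_gtP-/(_ isT t0)[i [ilt X0 tX]].
by exists (Ordinal ilt).
Qed.

Lemma prob_Fplus_le_ub n t : d%:R <= t ->
  (P^* [set w | (Fplus (sample X w) n <= t)%R] <=
   (expR (- (n%:R * ((t / (4 * d)%:R) ^+ d' * expR (- t)))))%:E)%E.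
Proof.
move=> dt; have t0 : 0 <= t by exact: le_trans dt.
have large i := prob_large_sum_lb i dt.
apply: (le_trans _ (prob_avoid_ub n (obs_sigma_large_sum X t) large)).
apply: le_outer_measure => w /= Ft i ilt [X0 tX].
suff : t < Fplus (sample X w) n by rewrite ltNge Ft.
by apply/Fplus_gtP => //; exists i.
Qed.

Lemma prob_dominated_ub n x : orthant x ->
  (P^* [set w | dominated (sample X w) n x] <= (n%:R * expR (- coord_sum x))%:E)%E.
Proof.
move=> x0; rewrite -[in n%:R](card_ord n).
have PA (i : 'I_n) : (P^* (above X x i) <= (expR (- coord_sum x))%:E)%E.
  by rewrite outer_probabilityE ?(prob_above indepX expX)//; exact: measurable_above.
apply: (le_trans _ (outer_measure_bigcup_fin PA)).
by apply: le_outer_measure => w [i ilt xi]; exists (Ordinal ilt).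
Qed.

Lemma prob_not_dominated_ub n x : orthant x ->
  (P^* [set w | ~ dominated (sample X w) n x] <=
   (expR (- (n%:R * expR (- coord_sum x))))%:E)%E.
Proof.
move=> x0; have PA i : ((expR (- coord_sum x))%:E <= P (above X x i))%E.
  by rewrite (prob_above indepX expX).
apply: (le_trans _ (prob_avoid_ub n (obs_sigma_above X x) PA)).
by apply: le_outer_measure => w /= nd i ilt xi; apply: nd; exists i.
Qed.

Lemma Fminus_lt_grid w n c : 0 < c -> Fminus (sample X w) n < c ->
  exists2 p : {ffun 'I_d -> 'I_(Num.truncn c).+2},
    coord_sum (grid_point 0 [ffun j => val (p j)]) <= c + d%:R &
    ~ dominated (sample X w) n (grid_point 0 [ffun j => val (p j)] : 'rV[R]_d).
Proof.
move=> c0 Fc; have [x [x0 xc ndx]] : exists x,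
    [/\ orthant x, coord_sum x < c & ~ dominated (sample X w) n x].
  move: Fc; rewrite ltNge => /negP; apply: contra_notP => /forallNP nx.
  by apply/Fminus_geP => // x x0 xc; apply: contrapT => ndx; apply: (nx x).
have xle j : x ord0 j <= c.
  apply: le_trans (ltW xc); rewrite /coord_sum (bigD1 j)//= lerDl.
  by apply: sumr_ge0 => k _; exact: x0.
have ltc j : (grid_round_up 0 x j < (Num.truncn c).+2)%N.
  by rewrite ffunE !ltnS le_truncn// mulr1.
pose p : {ffun 'I_d -> 'I_(Num.truncn c).+2} := [ffun j => Ordinal (ltc j)].
have pE : [ffun j => val (p j)] = grid_round_up 0 x by apply/ffunP => j; rewrite !ffunE.
exists p; rewrite pE.
- apply: le_trans (coord_sum_grid_round_up 0 x0) _.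
  by rewrite divr1 lerD2r ltW.
- move=> /dominatedW dom; apply/ndx/dom => j; exact/ltW/grid_round_up_gt.
Qed.

Lemma prob_Fminus_lt_ub n c : 0 < c ->
  (P^* [set w | (Fminus (sample X w) n < c)%R] <=
   ((c + 2) ^+ d * expR (- (n%:R * expR (- (c + d%:R)))))%:E)%E.
Proof.
move=> c0; pose K := (Num.truncn c).+2.
pose g (p : {ffun 'I_d -> 'I_K}) : 'rV[R]_d := grid_point 0 [ffun j => val (p j)].
pose A p :=
  [set w | (coord_sum (g p) <= c + d%:R)%R /\ ~ dominated (sample X w) n (g p)].
have PA p : (P^* (A p) <= (expR (- (n%:R * expR (- (c + d%:R)))))%:E)%E.
  have [gc|gc] := leP (coord_sum (g p)) (c + d%:R); last first.
    rewrite (_ : A p = set0) ?outer_measure0 ?lee_fin ?expR_ge0//.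
    by apply/seteqP; split=> w // -[]; rewrite leNgt gc.
  apply: (@le_trans _ _ (P^* [set w | ~ dominated (sample X w) n (g p)])).
    by apply: le_outer_measure => w [].
  apply: le_trans (prob_not_dominated_ub _ _) _; first exact: orthant_grid_point.
  by rewrite lee_fin ler_expR lerN2 ler_wpM2l// ler_expR lerN2.
apply: (@le_trans _ _ (P^* (\bigcup_p A p))).
  by apply: le_outer_measure => w /(Fminus_lt_grid c0)[p gc nd]; exists p.
apply: le_trans (outer_measure_bigcup_fin PA) _.
rewrite card_ffun !card_ord lee_fin natrX ler_pM2r ?expR_gt0// lerXn2r ?nnegrE//.
  by rewrite addr_ge0// ltW.
by rewrite /K -addn2 natrD lerD2r truncn_le ltW.
Qed.

Lemma prob_above_injective_ub m (f : 'I_m -> nat) (x : 'I_m -> 'rV[R]_d) :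
  injective f -> (forall a, orthant (x a)) ->
  (P^* (\bigcap_a above X (x a) (f a)) <= (expR (- \sum_a coord_sum (x a)))%:E)%E.
Proof.
move=> injf x0; pose s := [seq f a | a <- enum 'I_m].
pose y i : 'rV[R]_d := if [pick a | f a == i] is Some a then x a else 0.
have yf a : y (f a) = x a.
  by rewrite /y; case: pickP => [b /eqP/injf -> //|/(_ a)]; rewrite eqxx.
have us : uniq s by rewrite map_inj_uniq// enum_uniq.
have := independent_obs_sigma indepX us (A := fun i => above X (y i) i)
  (fun i _ => obs_sigma_above X (y i) i).
rewrite !(big_map f) => PA.
have -> : \bigcap_a above X (x a) (f a) =
    \big[setI/setT]_(a <- enum 'I_m) above X (y (f a)) (f a).
  rewrite -bigcap_seq; apply/seteqP; split=> w xw a _; rewrite ?yf; first exact: xw.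
  by rewrite -yf; apply: xw; rewrite /= mem_enum.
rewrite outer_probabilityE; last first.
  by apply: measurable_bigsetI => a _; exact: measurable_above.
rewrite PA -sumrN expR_sum -prodEFin big_enum/=.
by under eq_bigr do rewrite yf (prob_above indepX expX)//.
Qed.

Lemma prob_all_dominated_ub n m (x : 'I_m -> 'rV[R]_d) M :
  (forall a, orthant (x a)) ->
  (forall a b, a != b -> M <= coord_sum (join_point (x a) (x b))) ->
  (P^* [set w | forall a, dominated (sample X w) n (x a)] <=
   (n%:R ^+ m * expR (- \sum_a coord_sum (x a)) + (m * m * n)%:R * expR (- M))%:E)%E.
Proof.
move=> x0 xM.
pose A (f : {ffun 'I_m -> 'I_n}) :=
  [set w | injective f /\ (\bigcap_a above X (x a) (f a)) w].
pose B (p : 'I_m * 'I_m * 'I_n) :=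
  [set w | p.1.1 != p.1.2 /\ above X (join_point (x p.1.1) (x p.1.2)) p.2 w].
have PA f : (P^* (A f) <= (expR (- \sum_a coord_sum (x a)))%:E)%E.
  have [injf|ninj] := pselect (injective f); last first.
    rewrite (_ : A f = set0) ?outer_measure0 ?lee_fin ?expR_ge0//.
    by apply/seteqP; split=> w // -[].
  apply: (le_trans _ (prob_above_injective_ub (f := fun a => f a) _ x0)).
    by apply: le_outer_measure => w [].
  by move=> a b /ord_inj/injf.
have PB p : (P^* (B p) <= (expR (- M))%:E)%E.
  case: p => [[a b] i]; have [ab|ab] := eqVneq a b.
    rewrite (_ : B _ = set0) ?outer_measure0 ?lee_fin ?expR_ge0//.
    by apply/seteqP; split=> w // -[/=]; rewrite ab eqxx.
  apply: (@le_trans _ _ (P^* (above X (join_point (x a) (x b)) i))).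
    by apply: le_outer_measure => w [].
  rewrite outer_probabilityE; last exact: measurable_above.
  rewrite (prob_above indepX expX); last exact: orthant_join_point.
  by rewrite lee_fin ler_expR lerN2 xM.
apply: (@le_trans _ _ (P^* (\bigcup_f A f `|` \bigcup_p B p))).
  apply: le_outer_measure => w /all_dominated_injective_or_join[[f injf xf]|].
    by left; exists f => //; split=> // a _; exact: xf.
  by move=> [a [b [i [ab xi]]]]; right; exists (a, b, i).
rewrite EFinD; apply: (le_trans (outer_measureU2 _ _ _)); apply: leeD.
  by apply: le_trans (outer_measure_bigcup_fin PA) _; rewrite card_ffun !card_ord natrX.
by apply: le_trans (outer_measure_bigcup_fin PB) _; rewrite !card_prod !card_ord.
Qed.

Lemma log_decay_Fminus_lt e : 0 < e ->
  log_decay P (fun n => [set w | Fminus (sample X w) n < level (- e) n]) 2.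
Proof.
move=> e0; exists (2 ^+ d); have bounds := near_level_bounds (- e).
have decay := near_ln_nat (near_expRN_powR_le (d%:R + 2) (expR_gt0 (- d%:R)) e0).
near=> n; have n1 : (1 < n)%N by near: n; exact: nbhs_infty_gt.
have l0 : 0 < ln (n%:R : R) by rewrite ln_gt0// ltr1n.
have /andP[lo hi] : ln n%:R / 2 <= level (- e) n <= 2 * ln n%:R - 2 by near: n.
have c0 : 0 < level (- e) n by rewrite (lt_le_trans _ lo)// divr_gt0.
apply: le_trans (prob_Fminus_lt_ub n c0) _; rewrite lee_fin.
rewrite opprD expRD mulrA natr_expR_level// opprK [_ `^ e * _]mulrC.
have c2 : 0 <= level (- e) n + 2 by rewrite addr_ge0// ltW.
have cl : (level (- e) n + 2) ^+ d <= (2 * ln n%:R) ^+ d.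
  by rewrite lerXn2r ?nnegrE//; lra.
apply: le_trans (ler_pM (exprn_ge0 d c2) (expR_ge0 _) cl (near decay n _)) _ => //.
rewrite exprMn -mulrA ler_pM2l ?exprn_gt0// -powR_mulrn ?(ltW l0)// -powRD.
  by rewrite opprD addrA subrr add0r.
by rewrite (gt_eqF l0) implybT.
Unshelve. all: by end_near. Qed.

Lemma log_decay_Fminus_gt_weak e : 0 < e ->
  log_decay P (fun n => [set w | level e n < Fminus (sample X w) n]) (e / 2).
Proof.
move=> e0; exists 1; have bounds := near_level_bounds (e / 2).
near=> n; have n1 : (1 < n)%N by near: n; exact: nbhs_infty_gt.
have l0 : 0 < ln (n%:R : R) by rewrite ln_gt0// ltr1n.
have ll0 : 0 < ln (ln (n%:R : R)) by near: n; exact: near_lnln_gt0.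
have /andP[lo _] : ln n%:R / 2 <= level (e / 2) n <= 2 * ln n%:R - 2 by near: n.
have c0 : 0 < level (e / 2) n by rewrite (lt_le_trans _ lo)// divr_gt0.
have ce : level (e / 2) n < level e n by rewrite ltrD2l ltr_pM2r//; lra.
pose x : 'rV[R]_d := two_coord ord0 ord0 (level (e / 2) n) 0.
have x0 : orthant x by apply: orthant_two_coord => //; exact: ltW.
have sumx : coord_sum x = level (e / 2) n by rewrite coord_sum_two_coord addr0.
rewrite mul1r -natr_expR_level// -sumx; apply: le_trans (prob_dominated_ub n x0).
apply: le_outer_measure => w /= /ltW Fe.
move/Fminus_geP: Fe; apply => //; first exact: lt_trans ce.
by rewrite sumx.
Unshelve. all: by end_near. Qed.

(* The test points are spread along the segment joining two axes in the simplex
   [x_+ = c]; the join of any two of them has a coordinate sum larger by [c / m]. *)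
Lemma prob_Fminus_gt_ub n m (c : R) : (0 < d')%N -> (0 < m)%N -> 0 <= c ->
  (P^* [set w | (c < Fminus (sample X w) n)%R] <=
   (n%:R ^+ m.+1 * expR (- (m.+1%:R * c)) +
    (m.+1 * m.+1 * n)%:R * expR (- (c + c / m%:R)))%:E)%E.
Proof.
move=> d0 m0 c0; pose r := c / m%:R; have mr : m%:R * r = c.
  by rewrite mulrC divfK// pnatr_eq0 -lt0n.
have r0 : 0 <= r by rewrite divr_ge0.
pose j1 : 'I_d := lift ord0 (Ordinal d0).
pose x (a : 'I_m.+1) : 'rV[R]_d := two_coord ord0 j1 (a%:R * r) ((m - a)%:R * r).
have x0 a : orthant (x a) by apply: orthant_two_coord; rewrite mulr_ge0.
have sumx a : coord_sum (x a) = c.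
  by rewrite coord_sum_two_coord -mulrDl -natrD subnKC// -ltnS.
have joinx a b : a != b -> c + r <= coord_sum (join_point (x a) (x b)).
  wlog ab : a b / (a < b)%N => [wlog_lt|_].
    case: (ltngtP a b) => [|ba|/ord_inj ->]; [exact: wlog_lt| |by rewrite eqxx].
    by rewrite eq_sym coord_sum_join_pointC; exact: wlog_lt.
  apply: (le_trans _ (coord_sum_join_two_coord _ _ _ _ _)); rewrite ?mulr_ge0//.
  rewrite -mulrDl -natrD -mr -[X in _ + X]mul1r -mulrDl ler_wpM2r// natr1 ler_nat.
  by move: (ltn_ord b); lia.
have := prob_all_dominated_ub n x0 joinx.
under eq_bigr do rewrite sumx.
rewrite sumr_const card_ord -[c *+ _]mulr_natl => Pdom; apply: (le_trans _ Pdom).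
apply: le_outer_measure => w /= cF a; have c'0 := le_lt_trans c0 cF.
by move/Fminus_geP: (lexx (Fminus (sample X w) n)); apply; rewrite ?sumx.
Qed.

Lemma log_decay_Fminus_gt e : (0 < d')%N -> 0 < e ->
  log_decay P (fun n => [set w | level e n < Fminus (sample X w) n]) 2.
Proof.
move=> d0 e0; pose m := (Num.truncn (2 / e)).+1.
have me : 2 <= m.+1%:R * e.
  rewrite -ler_pdivrMr//; apply: ltW; apply: lt_trans (truncnS_gt _) _.
  by rewrite ltr_nat.
exists (1 + (m.+1 * m.+1)%:R); have bounds := near_level_bounds e.
have m2 : 0 < (2 * m%:R)^-1 :> R by rewrite invr_gt0 mulr_gt0.
have decay := near_ln_nat (near_expRN_powR_le 2 m2 ltr01).
near=> n; have n1 : (1 < n)%N by near: n; exact: nbhs_infty_gt.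
have l1 : 1 <= ln (n%:R : R) by near: n; exact: near_ln_ge.
have ll0 : 0 <= ln (ln (n%:R : R)) by exact: ln_ge0.
have /andP[lo _] : ln n%:R / 2 <= level e n <= 2 * ln n%:R - 2 by near: n.
have c0 : 0 <= level e n by lra.
apply: le_trans (prob_Fminus_gt_ub n (m := m) d0 isT c0) _.
rewrite lee_fin [leRHS]mulrDl mul1r; apply: lerD.
  rewrite -mulrN expRM_natl -exprMn natr_expR_level// -powR_mulrn ?powR_ge0// -powRrM.
  by apply: ler_powR => //; rewrite mulNr mulrC lerN2.
rewrite natrM -mulrA ler_pM2l ?ltr0n// [- (_ + _)]opprD expRD mulrA natr_expR_level//.
have le1 : ln n%:R `^ (- e) <= 1 :> R.
  by rewrite -[leRHS](powRr0 (ln n%:R)) ler_powR// oppr_le0 ltW.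
apply: le_trans (ler_piMl (expR_ge0 _) le1) _; apply: le_trans (near decay n _) => //.
rewrite ler_expR lerN2 powRr1 ?(le_trans ler01)// invfM mulrAC.
by rewrite ler_pM2r ?invr_gt0// mulrC.
Unshelve. all: by end_near. Qed.

Lemma log_decay_Fplus_gt s :
  log_decay P (fun n => [set w | level s n < Fplus (sample X w) n]) (s - d'%:R).
Proof.
exists (2 ^+ d' * expR d'%:R); have bounds := near_level_bounds s.
near=> n; have n1 : (1 < n)%N by near: n; exact: nbhs_infty_gt.
have l0 : 0 < ln (n%:R : R) by rewrite ln_gt0// ltr1n.
have /andP[lo hi] : ln n%:R / 2 <= level s n <= 2 * ln n%:R - 2 by near: n.
have t0 : 0 <= level s n by rewrite (le_trans _ lo)// divr_ge0// ltW.
apply: le_trans (prob_Fplus_gt_ub n t0) _; rewrite lee_fin.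
have -> : n%:R * ((level s n + 2) ^+ d' * expR (d'%:R - level s n)) =
    expR d'%:R * ln n%:R `^ (- s) * (level s n + 2) ^+ d'.
  by rewrite -natr_expR_level// expRD; ring.
have -> : 2 ^+ d' * expR d'%:R * ln n%:R `^ (- (s - d'%:R)) =
    expR d'%:R * ln n%:R `^ (- s) * (2 * ln n%:R) ^+ d'.
  rewrite opprB addrC powRD ?(gt_eqF l0) ?implybT// powR_mulrn ?(ltW l0)// exprMn.
  by ring.
rewrite ler_pM2l ?mulr_gt0 ?expR_gt0 ?powR_gt0// lerXn2r ?nnegrE//; lra.
Unshelve. all: by end_near. Qed.

Lemma log_decay_Fplus_lt e : 0 < e ->
  log_decay P (fun n => [set w | Fplus (sample X w) n < level (d'%:R - e) n]) 2.
Proof.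
move=> e0; exists 1; have bounds := near_level_bounds (d'%:R - e).
have a0 : 0 < ((8 * d)%:R : R) ^- d' by rewrite invr_gt0 exprn_gt0// ltr0n muln_gt0.
have decay := near_ln_nat (near_expRN_powR_le 2 a0 e0).
near=> n; have n1 : (1 < n)%N by near: n; exact: nbhs_infty_gt.
have l0 : 0 < ln (n%:R : R) by rewrite ln_gt0// ltr1n.
have ld : 2 * d%:R <= ln (n%:R : R) by near: n; exact: near_ln_ge.
have /andP[lo _] : ln n%:R / 2 <= level (d'%:R - e) n <= 2 * ln n%:R - 2 by near: n.
have dt : d%:R <= level (d'%:R - e) n by rewrite (le_trans _ lo)// ler_pdivlMr// mulrC.
apply: le_trans (le_outer_measure _ _ _ _) (le_trans (prob_Fplus_le_ub n dt) _).
  by move=> w /ltW; exact.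
rewrite lee_fin mul1r.
apply: le_trans (near decay n _) => //; rewrite ler_expR lerN2.
rewrite mulrCA natr_expR_level//.
apply: (@le_trans _ _ ((ln n%:R / (8 * d)%:R) ^+ d' * ln n%:R `^ (- (d'%:R - e)))).
  rewrite opprB powRB ?(gt_eqF l0) ?implybT// powR_mulrn ?(ltW l0)// expr_div_n.
  rewrite [leRHS](_ : _ = (8 * d)%:R ^- d' * ln n%:R `^ e)//; field.
  by rewrite !expf_neq0 ?gt_eqF.
rewrite ler_wpM2r ?powR_ge0// lerXn2r ?nnegrE ?divr_ge0 ?(ltW l0) ?(le_trans _ dt)//.
by rewrite (_ : (8 * d)%:R = 2 * (4 * d)%:R) ?invfM ?mulrA ?ler_pM2r ?invr_gt0
  -?natrM ?mulnA.
Unshelve. all: by end_near. Qed.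

Lemma near_prob_large_sum_level_lb : \forall n \near \oo, forall i,
  (((4 * d)%:R ^- d' * (n%:R * ln n%:R)^-1)%:E <= P (large_sum X (level d%:R n) i))%E.
Proof.
near=> n => i; have n1 : (1 < n)%N by near: n; exact: nbhs_infty_gt.
have n0 : n%:R != 0 :> R by rewrite pnatr_eq0 -lt0n ltnW.
have ld : d%:R <= ln (n%:R : R) by near: n; exact: near_ln_ge.
have l0 : 0 < ln (n%:R : R) by rewrite (lt_le_trans _ ld).
have lt : ln n%:R <= level d%:R n :> R.
  by rewrite lerDl mulr_ge0//; near: n; exact: near_lnln_ge.
have dt := le_trans ld lt.
apply: (le_trans _ (prob_large_sum_lb _ dt)); rewrite lee_fin.
have -> : expR (- level d%:R n) = n%:R^-1 * ln n%:R ^- d :> R.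
  by rewrite -powR_invn ?(ltW l0)// -natr_expR_level// mulKf.
have -> : (4 * d)%:R ^- d' * (n%:R * ln n%:R)^-1 =
    (ln n%:R / (4 * d)%:R) ^+ d' * (n%:R^-1 * ln n%:R ^- d) :> R.
  have : ln n%:R ^+ d' != 0 :> R by rewrite expf_neq0 ?gt_eqF.
  rewrite exprS expr_div_n; move: (ln n%:R ^+ d') ((4 * d)%:R ^+ d') => u v u0.
  by rewrite !invfM [RHS]mulrC !mulrA mulfVK// -mulrA mulrC.
rewrite ler_wpM2r ?mulr_ge0 ?invr_ge0 ?exprn_ge0 ?(ltW l0)//.
rewrite lerXn2r ?nnegrE ?divr_ge0 ?(ltW l0) ?(le_trans _ dt)//.
by rewrite ler_pM2r// invr_gt0 ltr0n.
Unshelve. all: by end_near. Qed.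

Lemma ae_io_Fplus_gt :
  {ae P, forall w, infinitely_often (fun n => level d%:R n < Fplus (sample X w) n)}.
Proof.
pose c : R := (4 * d)%:R ^- d'.
have c0 : 0 < c by rewrite invr_gt0 exprn_gt0// ltr0n muln_gt0.
pose p (i : nat) : R := c * (i.+1%:R * ln i.+1%:R)^-1.
have divp : series p n @[n --> \oo] --> +oo.
  apply/cvgryPge => a; have := @dvg_series_inv_mul_ln R => /cvgryPge/(_ (a / c)).
  by apply: filterS => n; rewrite ler_pdivrMr// mulrC /series/= mulr_sumr.
pose A i := large_sum X (level d%:R i.+1) i.
have pA : \forall i \near \oo, ((p i)%:E <= P (A i))%E.
  have [N _ PN] := near_prob_large_sum_level_lb.
  by exists N => // i Ni; exact: PN (leqW Ni) i.
have [M _ level0] : \forall n \near \oo, 0 <= level (d%:R : R) n.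
  by apply: filterS2 (near_level_bounds d%:R) (near_ln_ge 0) => n /andP[lo _] l0; lra.
apply: filterS (borel_cantelli_independent (independent_obs_sigma indepX)
  (measurable_obs_sigma X) (obs_sigmaC X) (fun i => obs_sigma_large_sum X _ i) pA divp).
move=> w io N; have [i] := io (maxn N M); rewrite geq_max => /andP[Ni Mi] [X0 tX].
exists i.+1; first exact: leqW.
by apply/Fplus_gtP => //; [exact: level0 (leqW Mi)|exists i].
Qed.

Lemma measurable_Fplus n : measurable_fun [set: T] (fun w => Fplus (sample X w) n).
Proof.
move=> mT; apply: (measurability _ (measurable_realfun.RGenOInfty.measurableE R)) => //.
move=> _ [_ [x ->] <-]; rewrite setTI; have [x0|x0] := ltP x 0.
  rewrite (_ : _ @^-1` _ = setT)//; apply/seteqP; split=> w //= _.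
  by rewrite in_itv/= andbT (lt_le_trans x0)// Fplus_ge0.
rewrite (_ : _ @^-1` _ = \bigcup_(i in [set i | (i < n)%N]) large_sum X x i).
  by apply: bigcup_measurable => i _; exact: measurable_large_sum.
apply/seteqP; split=> w /=; rewrite in_itv/= andbT.
  by move=> /Fplus_gtP-/(_ isT x0)[i [ilt pi xi]]; exists i.
by move=> [i ilt [pi xi]]; apply/Fplus_gtP => //; exists i.
Qed.

Lemma measurable_dominated n (x : 'rV[R]_d) :
  measurable [set w | dominated (sample X w) n x].
Proof.
rewrite (_ : mkset _ = \bigcup_(i in [set i | (i < n)%N]) above X x i).
  by apply: bigcup_measurable => i _; exact: measurable_above.
by apply/seteqP; split=> w [i ilt xi]; exists i.
Qed.

Lemma measurable_Fminus n : measurable_fun [set: T] (fun w => Fminus (sample X w) n).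
Proof.
move=> mT; apply: (measurability _ (measurable_realfun.RGenCInfty.measurableE R)) => //.
move=> _ [_ [x ->] <-]; rewrite setTI; have [x0|x0] := leP x 0.
  rewrite (_ : _ @^-1` _ = setT)//; apply/seteqP; split=> w //= _.
  by rewrite in_itv/= andbT (le_trans x0)// Fminus_ge0.
pose undom (kp : nat * {ffun 'I_d -> nat}) := if coord_sum (grid_point kp.1 kp.2) < x
  then ~` [set w | dominated (sample X w) n (grid_point kp.1 kp.2)] else set0.
rewrite (_ : _ @^-1` _ = ~` \bigcup_kp undom kp).
  apply/measurableC/countable_bigcupT_measurable; first exact: countableP.
  move=> kp; rewrite /undom; case: ifP => // _.
  exact/measurableC/measurable_dominated.
apply/seteqP; split=> w /=; rewrite in_itv/= andbT.
  move=> /Fminus_grid_geP-/(_ isT x0) dom [[k p] _]; rewrite /undom.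
  by case: ifP => // /dom.
move=> dom; apply/Fminus_grid_geP => // k p px; apply: contrapT => ndom.
by apply: dom; exists (k, p) => //; rewrite /undom px.
Qed.

Lemma measurable_width_deviation n l s e :
  measurable [set w | e < `|width X n w / l - s|].
Proof.
have mW : measurable_fun [set: T] (fun w => `|width X n w / l - s|).
  apply: measurableT_comp => //; apply: measurable_funB => //.
  apply: measurable_funM => //.
  by apply: measurable_funB; [exact: measurable_Fplus|exact: measurable_Fminus].
rewrite -[X in measurable X]setTI.
rewrite (_ : mkset _ = (fun w => `|width X n w / l - s|) @^-1` `]e, +oo[).
  exact: mW.
by apply/seteqP; split=> w /=; rewrite in_itv/= andbT.
Qed.

Lemma width_div_le n w s t : 0 < ln (ln (n%:R : R)) ->
  Fplus (sample X w) n <= level s n -> level t n <= Fminus (sample X w) n ->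
  width X n w / ln (ln n%:R) <= s - t.
Proof. by move=> l0 Fs tF; rewrite ler_pdivrMr// -levelB lerB. Qed.

Lemma width_div_ge n w s t : 0 < ln (ln (n%:R : R)) ->
  level s n <= Fplus (sample X w) n -> Fminus (sample X w) n <= level t n ->
  s - t <= width X n w / ln (ln n%:R).
Proof. by move=> l0 sF Ft; rewrite ler_pdivlMr// -levelB lerB. Qed.

Lemma width_cvg_in_probability e : 0 < e ->
  (fun n => P [set w | e < `|width X n w / ln (ln n%:R) - d'%:R|]) @ \oo --> 0%E.
Proof.
move=> e0; have e2 : 0 < e / 2 by rewrite divr_gt0.
have e4 : 0 < e / 2 / 2 by rewrite divr_gt0.
have gt0_2 : 0 < 2 :> R by [].
have dev : vanishing P (fun n => [set w | e < `|width X n w / ln (ln n%:R) - d'%:R|]).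
  have decay_gt : 0 < d'%:R + e / 2 - d'%:R by rewrite addrAC subrr add0r.
  apply: (vanishingS _ (vanishingU
    (vanishingU (log_decay_vanishing gt0_2 (log_decay_Fminus_lt e2))
       (log_decay_vanishing e4 (log_decay_Fminus_gt_weak e2)))
    (vanishingU (log_decay_vanishing gt0_2 (log_decay_Fplus_lt e2))
       (log_decay_vanishing decay_gt (log_decay_Fplus_gt _))))).
  near=> n => w; apply: contraPP => /not_orP[/not_orP[/= /negP + /negP +]].
  move=> + + /not_orP[/= /negP + /negP]; rewrite -!leNgt => Fm_ge Fm_le Fp_ge Fp_le.
  have l0 : 0 < ln (ln (n%:R : R)) by near: n; exact: near_lnln_gt0.
  have := width_div_le l0 Fp_le Fm_ge; have := width_div_ge l0 Fp_ge Fm_le.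
  by move=> Wge Wle; apply/negP; rewrite -leNgt ler_norml; apply/andP; split; lra.
apply: cvg_trans dev; apply: near_eq_cvg; apply: nearW => n.
by apply: outer_probabilityE; exact: measurable_width_deviation.
Unshelve. all: by end_near. Qed.

Lemma ae_Fminus_ge : {ae P, forall w, forall e, 0 < e ->
  \forall n \near \oo, level (0 - e) n <= Fminus (sample X w) n}.
Proof.
apply: ae_near_ge_level => [w|e e0]; first exact: Fminus_nondecreasing.
by exists 2; rewrite ?ltr1n// sub0r; exact: log_decay_Fminus_lt.
Qed.

Lemma ae_Fminus_le : (0 < d')%N -> {ae P, forall w, forall e, 0 < e ->
  \forall n \near \oo, Fminus (sample X w) n <= level (0 + e) n}.
Proof.
move=> d0; apply: ae_near_le_level => [w|e e0]; first exact: Fminus_nondecreasing.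
by exists 2; rewrite ?ltr1n// add0r; exact: log_decay_Fminus_gt.
Qed.

Lemma ae_Fplus_ge : {ae P, forall w, forall e, 0 < e ->
  \forall n \near \oo, level (d'%:R - e) n <= Fplus (sample X w) n}.
Proof.
apply: ae_near_ge_level => [w|e e0]; first exact: Fplus_nondecreasing.
by exists 2; rewrite ?ltr1n//; exact: log_decay_Fplus_lt.
Qed.

Lemma ae_Fplus_le : {ae P, forall w, forall e, 0 < e ->
  \forall n \near \oo, Fplus (sample X w) n <= level (d%:R + e) n}.
Proof.
apply: ae_near_le_level => [w|e e0]; first exact: Fplus_nondecreasing.
exists (d%:R + e - d'%:R); last exact: log_decay_Fplus_gt.
by rewrite (_ : d%:R + e - d'%:R = 1 + e) ?ltrDl// -natr1; ring.
Qed.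

Lemma ae_io_Fplus_le : {ae P, forall w, forall e, 0 < e ->
  infinitely_often (fun n => Fplus (sample X w) n <= level (d'%:R + e) n)}.
Proof.
apply: ae_forall_gt0 => [e e' w ee' io|e e0].
  have le_e : d'%:R + e <= d'%:R + e' by rewrite lerD2l.
  by apply: (infinitely_often_near io (near_level_le le_e)) => n; exact: le_trans.
have decay_gt : 0 < d'%:R + e - d'%:R by rewrite addrAC subrr add0r.
have := vanishing_ae (log_decay_vanishing decay_gt (log_decay_Fplus_gt _)).
apply: filterS => w io N; have [n Nn /negP] := io N.
by rewrite -leNgt => Fn; exists n.
Qed.

Lemma ae_liminf_width : (0 < d')%N -> {ae P, forall w,
  limn_einf (fun n => (width X n w / ln (ln n%:R))%:E) = d'%:R%:E}.
Proof.
move=> d0; apply: filterS3 ae_Fminus_ge (ae_Fminus_le d0)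
  (filterI ae_Fplus_ge ae_io_Fplus_le).
move=> w Fm_ge Fm_le [Fp_ge io_le]; apply: limn_einf_EFin => e e0;
  have e2 : 0 < e / 2 by rewrite divr_gt0.
- near=> n; have l0 : 0 < ln (ln (n%:R : R)) by near: n; exact: near_lnln_gt0.
  have Fp_n : level (d'%:R - e / 2) n <= Fplus (sample X w) n by near: n; exact: Fp_ge.
  have Fm_n : Fminus (sample X w) n <= level (0 + e / 2) n by near: n; exact: Fm_le.
  by have := width_div_ge l0 Fp_n Fm_n; lra.
- apply: (infinitely_often_near (io_le _ e2) (filterI near_lnln_gt0 (Fm_ge _ e2))).
  move=> n Fp_n [l0 Fm_n].
  by have := width_div_le l0 Fp_n Fm_n; lra.
Unshelve. all: by end_near. Qed.

Lemma ae_limsup_width : (0 < d')%N -> {ae P, forall w,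
  limn_esup (fun n => (width X n w / ln (ln n%:R))%:E) = d%:R%:E}.
Proof.
move=> d0; apply: filterS3 ae_Fminus_ge (ae_Fminus_le d0)
  (filterI ae_Fplus_le ae_io_Fplus_gt).
move=> w Fm_ge Fm_le [Fp_le io_gt]; apply: limn_esup_EFin => e e0.
- have e2 : 0 < e / 2 by rewrite divr_gt0.
  near=> n; have l0 : 0 < ln (ln (n%:R : R)) by near: n; exact: near_lnln_gt0.
  have Fp_n : Fplus (sample X w) n <= level (d%:R + e / 2) n by near: n; exact: Fp_le.
  have Fm_n : level (0 - e / 2) n <= Fminus (sample X w) n by near: n; exact: Fm_ge.
  by have := width_div_le l0 Fp_n Fm_n; lra.
- apply: (infinitely_often_near io_gt (filterI near_lnln_gt0 (Fm_le _ e0))).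
  move=> n /ltW Fp_n [l0 Fm_n].
  by have := width_div_ge l0 Fp_n Fm_n; lra.
Unshelve. all: by end_near. Qed.

End record_frontier.

Theorem theorem1p11 (R : realType) (d : nat) (dT : measure_display)
  (T : measurableType dT) (P : probability T R)
  (X : nat -> 'I_d -> {RV P >-> R}) :
  (1 <= d)%N ->
  mutually_independent (fun ij : nat * 'I_d => X ij.1 ij.2) ->
  (forall (i : nat) (j : 'I_d) (A : set R), measurable A ->
     distribution P (X i j) A = exponential_prob (1 : R) A) ->
  (* (a) convergence in probability *)
  (forall eps : R, 0 < eps ->
     (fun n : nat => P [set w | eps <
        `| width X n w / ln (ln n%:R) - (d%:R - 1) |]) @ \oo --> 0%E)
  /\
  (* (b) almost sure liminf / limsup for d >= 2 *)
  ((2 <= d)%N ->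
     {ae P, forall w,
        limn_einf (fun n : nat => (width X n w / ln (ln n%:R))%:E)
          = (d%:R - 1)%:E
        /\ limn_esup (fun n : nat => (width X n w / ln (ln n%:R))%:E)
          = (d%:R)%:E}).
Proof.
case: d X => [//|d'] X _ indepX expX.
have -> : d'.+1%:R - 1 = d'%:R :> R by rewrite -natr1 addrK.
split=> [eps|d2]; first exact: width_cvg_in_probability.
exact: filterS2 (ae_liminf_width indepX expX d2) (ae_limsup_width indepX expX d2).
Qed.
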